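(* Let $k$ be measurable, bounded and uniformly positive, let $\mathbf{A},\mathbf{L}\in\mathbb{R}^{N\times N}$ be the finite element stiffness matrices $[\mathbf{A}]_{ij}=\int_\Omega \nabla\phi_i\cdot k\nabla\phi_j$ and $[\mathbf{L}]_{ij}=\int_\Omega\nabla\phi_i\cdot\nabla\phi_j$, and let $0<\lambda_1\le\dots\le\lambda_N$ be the eigenvalues of $\mathbf{L}^{-1}\mathbf{A}$, counted with multiplicity. There exists a permutation $\pi$ of $\{1,\dots,N\}$ with $\lambda_{\pi(j)}\in k(\mathcal{T}_j)$ for all $j=1,\dots,N$, and for any such permutation $\pi$ the following holds. Let $j\in\{1,\dots,N\}$ and let $\hat{x}$ be any discretization mesh node such that $\hat{x}\in\mathcal{T}_j$. Then $$|\lambda_{\pi(j)}-k(\hat{x})|\le\sup_{x\in\mathcal{T}_j}|k(x)-k(\hat{x})|.$$ If, in addition, $k\in\mathcal{C}^2(\mathcal{T}_j)$, then $$|\lambda_{\pi(j)}-k(\hat{x})|\le\max_{x\in\mathcal{T}_j}|k(x)-k(\hat{x})|\le\hat{h}\,\|\nabla k(\hat{x})\|+\tfrac12\hat{h}^2\max_{x\in\mathcal{T}_j}\|D^2k(x)\|,$$ where $\hat{h}=\max_{x\in\mathcal{T}_j}\|x-\hat{x}\|$ and $D^2k(x)$ is the second order derivative of $k$ at $x$.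
   Context: Setting. $\Omega\subset\mathbb{R}^d$, $d\in\{1,2,3\}$, is a bounded domain. The coefficient $k$ is a real-valued, bounded, measurable function, defined pointwise on $\overline{\Omega}$, which is uniformly positive: there is $\alpha>0$ with $k(x)\ge\alpha$ for all $x\in\Omega$. $V_h\subset H_0^1(\Omega)$ is a conforming finite element space on a mesh of $\Omega$, with basis $\phi_1,\dots,\phi_N$ of (linearly independent) piecewise polynomial nodal basis functions with local supports. $\mathcal{T}_j=\mathrm{supp}(\phi_j)\subset\overline{\Omega}$ is the (closed) support of $\phi_j$. The matrices $\mathbf{A}$ and $\mathbf{L}$ are symmetric positive definite. Notation: $k(\mathcal{T}_j)$ denotes the closed interval $[\inf_{x\in\mathcal{T}_j}k(x),\ \sup_{x\in\mathcal{T}_j}k(x)]$. $\|\cdot\|$ is the Euclidean norm of vectors, and $\|D^2k(x)\|$ is the norm of the bilinear form $D^2k(x)$, i.e. $\sup\{|D^2k(x)(u,v)|:\|u\|=\|v\|=1\}$. $k\in\mathcal{C}^2(\mathcal{T}_j)$ means that $k$ is twice continuously differentiable on $\mathcal{T}_j$ (it coincides on $\mathcal{T}_j$ with a $\mathcal{C}^2$ function on an open neighbourhood of $\mathcal{T}_j$, whose derivatives are meant by $\nabla k$ and $D^2k$).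
   Formalization: The last inequality (max of |k(x)-k(x̂)| bounded by the Taylor expression) is proved only if d=1, x̂ is the node of φ_j itself, or T_j is star-shaped about x̂ (e.g. convex); for other mesh nodes of a non-convex T_j it can fail. *)

(* Defs.v *)
From HB Require Import structures.
From mathcomp Require Import all_boot all_order all_algebra all_fingroup.
From mathcomp Require Import all_classical all_reals all_analysis.
From mathcomp Require mpoly.

Set Implicit Arguments.
Unset Strict Implicit.
Unset Printing Implicit Defensive.
Import Order.TTheory GRing.Theory Num.Theory.
Import numFieldNormedType.Exports.

Local Open Scope classical_set_scope.
Local Open Scope ring_scope.

(* The ambient space R^d, d >= 1, is 'rV[R]_n.+1 with d = n.+1.  Its library
   norm is the sup norm: it gives the usual topology, but lengths have to be
   measured with [enorm]. *)

Section LebesgueMeasure.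
Context (R : realType) (n : nat).
Notation E := ('rV[R]_n.+1).

Definition box (c : E * E) : set E :=
  [set x | forall i, c.1 0 i <= x 0 i <= c.2 0 i].

Definition box_volume (c : E * E) : R :=
  \prod_i Num.max 0 (c.2 0 i - c.1 0 i).

Definition lebesgue_outer (A : set E) : \bar R :=
  ereal_inf [set (\sum_(k <oo) (box_volume (c k))%:E)%E |
             c in [set c : nat -> E * E | A `<=` \bigcup_k box (c k)]].

Lemma box_volume_ge0 c : 0 <= box_volume c.
Proof. by apply: prodr_ge0 => i _; rewrite le_max lexx. Qed.

Let volE_ge0 c : (0 <= (box_volume c)%:E)%E.
Proof. by rewrite lee_fin box_volume_ge0. Qed.

Lemma lebesgue_outer_ge0 A : (0 <= lebesgue_outer A)%E.
Proof. by apply: le_ereal_inf_tmp => x [c _ <-]; exact: nneseries_ge0. Qed.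

Lemma lebesgue_outer0 : lebesgue_outer set0 = 0%E.
Proof.
apply/eqP; rewrite eq_le lebesgue_outer_ge0 andbT.
apply: ereal_inf_lbound; exists (fun=> (0, 0)) => //=.
apply: eseries0 => k _ _; rewrite /box_volume (bigD1 ord0) //=.
by rewrite !mxE subrr maxxx mul0r.
Qed.

Lemma le_lebesgue_outer :
  {homo lebesgue_outer : A B / A `<=` B >-> (A <= B)%E}.
Proof.
move=> A B AB; apply/ereal_inf_le_tmp => x [c Bc <-{x}].
by exists c => //=; exact: subset_trans Bc.
Qed.

Lemma lebesgue_outer_sigma_subadditive : sigma_subadditive lebesgue_outer.
Proof.
move=> A; have [[i ioo]|] := pselect (exists i, lebesgue_outer (A i) = +oo%E).
  rewrite (eseries_pinfty _ _ ioo) ?leey// => k _.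
  by rewrite -ltNye (lt_le_trans _ (lebesgue_outer_ge0 _)).
rewrite -forallNE => Aoo.
suff add2e (e : {posnum R}) : (lebesgue_outer (\bigcup_n A n) <=
    \sum_(i <oo) lebesgue_outer (A i) + e%:num%:E)%E.
  by apply/lee_addgt0Pr => _/posnumP[].
rewrite (le_trans _ (epsilon_trick _ _ _))//; last first.
  by move=> k; exact: lebesgue_outer_ge0.
pose P m (c : nat -> E * E) := A m `<=` \bigcup_k box (c k) /\
  (\sum_(k <oo) (box_volume (c k))%:E
   <= lebesgue_outer (A m) + (e%:num / (2 ^ m.+1)%:R)%:E)%E.
have [G PG] : {G : nat -> nat -> E * E & forall m, P m (G m)}.
  apply: (@choice _ _ P) => m; rewrite /P /lebesgue_outer.
  set S := (X in ereal_inf X); move infS : (ereal_inf S) => iS.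
  case: iS infS => [r Sr|Soo|Soo].
  - have en1 : (0 < e%:num / (2 ^ m.+1)%:R)%R by [].
    have /(lb_ereal_inf_adherent en1) : ereal_inf S \is a fin_num by rewrite Sr.
    move=> [x [c Ac vx] xS].
    by exists c; split => //; rewrite vx -Sr; exact/ltW.
  - by have := Aoo m; rewrite /lebesgue_outer Soo.
  - suff : lbound S 0%E by move/le_ereal_inf_tmp; rewrite Soo.
    by move=> /= _ [c Ac <-]; exact: nneseries_ge0.
pose v (p : nat * nat) : \bar R := (box_volume (uncurry G p))%:E.
have v_ge0 p : (0 <= v p)%E by exact: volE_ge0.
apply: (@le_trans _ _ (\esum_(i in setT) v i)%E).
  apply: ereal_inf_lbound => /=.
  have /card_esym/ppcard_eqP[f] := card_nat2.
  exists (uncurry G \o f).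
    move=> t [i _ Ait]; have [j _ Bijt] := (PG i).1 t Ait.
    by exists (f^-1%FUN (i, j)) => //=; rewrite invK ?inE.
  rewrite -(esum_pred_image v _ xpredT) ?[fun=> _]set_true//.
  by rewrite image_eq.
rewrite (_ : esum _ _ = \sum_(i <oo) \sum_(j <oo) v (i, j))%E; last first.
  pose J : nat -> set (nat * nat) := fun i => [set (i, j) | j in setT].
  rewrite (_ : setT = \bigcup_k J k); last first.
    by rewrite predeqE => -[a b]; split => // _; exists a => //; exists b.
  rewrite esum_bigcupT //=; last first.
    apply/trivIsetP => i j _ _ ij.
    rewrite predeqE => -[k m] /=; split => //= -[] [_] _ [<-{k} _].
    by move=> [m' _] [] /esym/eqP; rewrite (negbTE ij).
  rewrite -(image_id [set: nat]) -fun_true esum_pred_image//; last first.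
    by move=> k _; exact: esum_ge0.
  apply: eq_eseriesr => /= j _.
  rewrite -(esum_pred_image v (pair j) predT)//=; last first.
    by move=> ? ? _ _; exact: (@can_inj _ _ _ snd).
  by congr esum; rewrite predeqE => -[a b]; split; move=> [i _ <-]; exists i.
apply: lee_lim.
- apply: is_cvg_nneseries => k *.
  by apply: nneseries_ge0 => m *; exact: (v_ge0 (k, m)).
- apply: is_cvg_nneseries => k *; apply: adde_ge0 => //.
  exact: lebesgue_outer_ge0.
- by near=> m; apply: lee_sum => i _; exact: (PG i).2.
Unshelve. all: by end_near. Qed.

HB.instance Definition _ := isOuterMeasure.Build R E lebesgue_outer
  lebesgue_outer0 lebesgue_outer_ge0 le_lebesgue_outer
  lebesgue_outer_sigma_subadditive.

(* R^d with the sigma-algebra of Lebesgue (i.e. Caratheodory) measurable sets *)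
Definition lebesgue_rV : set (caratheodory_type lebesgue_outer) -> \bar R :=
  lebesgue_outer.

HB.instance Definition _ := isMeasure.Build _ _ _ lebesgue_rV
  (@caratheodory_measure0 _ _ lebesgue_outer)
  (@caratheodory_measure_ge0 _ _ lebesgue_outer)
  (@caratheodory_measure_sigma_additive _ _ lebesgue_outer).

End LebesgueMeasure.

Section Calculus.
Context (R : realType) (n : nat).
Notation E := ('rV[R]_n.+1).
Implicit Types (f : E -> R) (x u v : E) (U T : set E).

Definition enorm x : R := Num.sqrt (\sum_i x 0 i ^+ 2).

Definition grad f x : E := \row_i 'D_(delta_mx 0 i) f x.

Definition C2_on U f : Prop :=
  [/\ forall x, U x -> differentiable f x,
      forall u x, U x -> differentiable ('D_u f) x &
      forall u v x, U x -> {for x, continuous ('D_v ('D_u f))}].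

Definition norm_D2 f x : R :=
  sup [set r | exists u v,
    [/\ enorm u = 1, enorm v = 1 & r = `|'D_v ('D_u f) x|]].

Definition C2_extension T (k : E -> R) U (K : E -> R) : Prop :=
  [/\ open U, T `<=` U, C2_on U K & {in T, K =1 k}].

Definition is_max_on T (g : E -> R) (m : R) : Prop :=
  (exists2 x, T x & g x = m) /\ (forall x, T x -> g x <= m).

(* Expanding k at x with remainder controlled by D^2 k on T alone requires the
   segments issued from x to stay in T. *)
Definition star_shaped_about x T : Prop :=
  forall y (t : R), T y -> 0 <= t <= 1 -> T (x + t *: (y - x)).

End Calculus.

Section Mesh.
Context (R : realType) (n : nat).
Notation E := ('rV[R]_n.+1).

Definition hull (I : finType) (p : I -> E) (S : {set I}) : set E :=
  [set x | exists w : I -> R, [/\ forall i, 0 <= w i,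
     \sum_(i in S) w i = 1 & x = \sum_(i in S) w i *: p i]].

(* A mesh of Omega by convex polytopes.  The nodes of a cell are at least its
   vertices; they may include further ones, e.g. edge midpoints. *)
Record mesh (Omega : set E) := Mesh {
  nnode : nat ;
  node : 'I_nnode -> E ;
  ncell : nat ;
  cell_nodes : 'I_ncell -> {set 'I_nnode} ;
  cell := fun c => hull node (cell_nodes c) ;
  node_inj : injective node ;
  cell_interior_neq0 : forall c, (cell c)° !=set0 ;
  cell_interior_disj : forall c c', c != c' -> (cell c)° `&` (cell c')° = set0 ;
  cell_cover : \bigcup_c cell c = closure Omega }.

End Mesh.

Arguments node {R n Omega} m i : rename.
Arguments cell {R n Omega} m c : rename.

Section FiniteElements.
Context (R : realType) (n : nat).
Notation E := ('rV[R]_n.+1).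

Definition polynomial_on (K : set E) (f : E -> R) : Prop :=
  exists p : mpoly.mpoly n.+1 R,
    forall x, K x -> f x = mpoly.meval (fun i => x 0 i) p.

(* Functions on Omega are extended by zero to R^d.  A function that is
   polynomial on each cell lies in H^1_0(Omega) when it is continuous and
   vanishes on the boundary, i.e. when its extension is continuous. *)
Record nodal_basis (Omega : set E) (M : mesh Omega) (N : nat)
    (dof : 'I_N -> 'I_(nnode M)) (phi : 'I_N -> E -> R) : Prop := NodalBasis {
  basis_continuous : forall j, continuous (phi j) ;
  basis_zero : forall j x, ~ Omega x -> phi j x = 0 ;
  basis_polynomial : forall j c, polynomial_on (cell M c) (phi j) ;
  basis_nodal : forall i j, phi i (node M (dof j)) = (i == j)%:R ;
  basis_local : forall j c, ~ cell M c (node M (dof j)) ->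
    forall x, cell M c x -> phi j x = 0 }.

Definition supp (f : E -> R) : set E := closure [set x | f x != 0].

(* [k = cst 1] gives the matrix L.  On the boundaries of the cells, a null set,
   the gradients need not exist. *)
Definition stiffness (Omega : set E) (k : E -> R) N (phi : 'I_N -> E -> R) :
    'M[R]_N :=
  \matrix_(i, j) (\int[@lebesgue_rV R n]_(x in Omega)
     (\sum_l grad (phi i) x 0 l * (k x * grad (phi j) x 0 l)))%R.

End FiniteElements.

Section Spectrum.
Context (R : realType).

(* the eigenvalues of B in nondecreasing order, counted with multiplicity *)
Definition ordered_spectrum N (B : 'M[R]_N) (lam : 'I_N -> R) : Prop :=
  {homo lam : i j / (i <= j)%N >-> i <= j} /\
  char_poly B = \prod_i ('X - (lam i)%:P).

End Spectrum.

(* Main.v *)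
(* Write V_J for the span of the basis functions phi_j, j in J.  If k lies in
   [s, t] on the supports of these functions, then, with kap = (s + t) / 2 and
   r = (t - s) / 2, the form of A - kap L satisfies
   2 (A - kap L)(v, w) <= r (L(v, v) + L(w, w)) for v in V_J and all w.
   Diagonalising the pencil (A, L), this forces at least dim V_J = #|J|
   eigenvalues into [s, t].  Hence every interval [s, t] contains at least as
   many eigenvalues as it contains intervals k(T_j), which is enough to match
   eigenvalues with intervals greedily.  The remaining estimates follow from
   inf k <= lambda <= sup k on T_j and from Taylor's formula along the segments
   issued from xhat; T_j is the union of the cells containing the j-th node,
   since a nonzero polynomial cannot vanish on an open set, so it is star-shaped
   about that node.

   That L is positive definite and that the stiffness integrals are bilinear
   require that boundaries of cells are Lebesgue null and that nonempty open
   sets are not. *)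

(* That w ranges over the whole space is what makes the count work. If v and w were both confined to
   V_J, the bound would only control the compression of the pencil to V_J, whose eigenvalues need
   not be eigenvalues of the pencil. With w free it says, in the norm given by L, that |(L^-1 A -
   kap) v| <= r |v| on V_J, so a nonzero v in V_J cannot be a combination of eigenvectors whose
   eigenvalues are all farther than r from kap. This freedom costs nothing: the gradient of v
   vanishes off the supports belonging to J, so k - kap only has to be small there, whatever w is.

   The counts concern intervals [s, t] only, not arbitrary families of the sets k(T_j) as in Hall's
   theorem; on a line these suffice.

   The measure is an infimum over countable coverings by boxes, so the positivity of open sets rests
   on a covering inequality, while null boundaries come from scaling. Gradients are controlled only
   off the cell boundaries, which is why boundedness is asked for only there. *)
Require Import Defs.
From mathcomp Require Import all_boot all_order all_algebra all_fingroup.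
From mathcomp Require Import all_classical all_reals all_analysis.
From mathcomp Require Import measurable_realfun ring lra.
From mathcomp Require mpoly.

Set Implicit Arguments.
Unset Strict Implicit.
Unset Printing Implicit Defensive.
Import Order.TTheory GRing.Theory Num.Theory.
Import numFieldNormedType.Exports.

Local Open Scope ring_scope.

(** * Matching points with intervals *)

(* Greedy choice: the interval with the smallest right end takes the smallest
   point it contains. *)
Lemma interval_matching (R : realFieldType) (I J : finType) (x : I -> R)
    (a b : J -> R) (ab : forall j, a j <= b j) (Q : {set J}) (P : {set I}) :
    (forall s t : R, s <= t ->
      (#|[set j in Q | (s <= a j)%R && (b j <= t)%R]| <=
       #|[set i in P | (s <= x i <= t)%R]|)%N) ->
  exists f : J -> option I,
    (forall j, j \in Q -> exists2 i, f j = Some i & (i \in P) && (a j <= x i <= b j)) /\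
    {in Q &, injective f}.
Proof.
move: {2}#|Q| (erefl #|Q|) => m.
elim: m => [|m IH] in Q P * => cQ count.
  (* [I] may be empty, so the matching is a partial function; [None] is its value outside [Q]. *)
  exists (fun=> None); move/eqP: cQ; rewrite cards_eq0 => /eqP ->.
  by split => [j|j ?]; rewrite inE.
have [j0 j0Q] : exists j0, j0 \in Q by apply/card_gt0P; rewrite cQ.
case: (arg_minP b j0Q) => j1 j1Q minb; have {}j1Q : j1 \in Q := j1Q.
have [i0 i0P] : exists i, i \in [set i in P | a j1 <= x i <= b j1].
  apply/card_gt0P; apply: leq_trans (count _ _ (ab j1)).
  by apply/card_gt0P; exists j1; rewrite inE j1Q !lexx.
case: (arg_minP x i0P) => i1 i1S minx.
have := i1S : i1 \in [set i in P | (a j1 <= x i <= b j1)%R].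
rewrite inE => /andP[i1P /andP[ai1 bi1]].
have cQ1 : #|Q :\ j1| = m by apply/eqP; rewrite -eqSS -cQ (cardsD1 j1 Q) j1Q.
have [|f [f1 f2]] := IH (Q :\ j1) (P :\ i1) cQ1.
  move=> s t st.
  have EP u : [set i in P :\ i1 | (u <= x i <= t)%R] = [set i in P | (u <= x i <= t)%R] :\ i1.
    by apply/setP => i; rewrite !inE; case: (i == i1).
  have EQ u : [set j in Q :\ j1 | (u <= a j)%R && (b j <= t)%R] =
      [set j in Q | (u <= a j)%R && (b j <= t)%R] :\ j1.
    by apply/setP => j; rewrite !inE; case: (j == j1).
  rewrite EP EQ.
  (* For t below [b j1], the least right end, no interval of [Q] fits into [s, t]. *)
  have [bt|tb] := leP (b j1) t; last first.
    rewrite eq_card0// => j; rewrite !inE; apply/negP => /and4P[_ jQ _ bj].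
    by have := lt_le_trans tb (minb _ jQ); rewrite ltNge bj.
  (* A range [u, t] containing [a j1, b j1] loses exactly one interval and one point, so the
     inequality persists. *)
  have ut u : u <= a j1 -> (#|[set j in Q | (u <= a j)%R && (b j <= t)%R] :\ j1| <=
      #|[set i in P | (u <= x i <= t)%R] :\ i1|)%N.
    move=> ua; rewrite -ltnS.
    have := count u t (le_trans ua (le_trans (ab j1) bt)).
    rewrite (cardsD1 j1) (cardsD1 i1 [set i in P | _]) !inE j1Q i1P ua bt.
    by rewrite (le_trans ua ai1) (le_trans bi1 bt).
  have [sa|as_] := leP s (a j1); first exact: ut.
  have [xs|sx] := ltP (x i1) s.
    have -> : [set i in P | (s <= x i <= t)%R] :\ i1 = [set i in P | (s <= x i <= t)%R].
      by apply/setP => i; rewrite !inE; case: eqVneq => // ->; rewrite leNgt xs andbF.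
    apply: leq_trans (count s t st); apply: subset_leq_card; exact: subD1set.
  (* Here a j1 < s <= x i1. Enlarging [s, t] to [a j1, t] keeps its intervals and adds no point: a
     point of [P] in [a j1, b j1] is at least x i1, hence at least s. *)
  have /leq_trans -> // : (#|[set j in Q | (s <= a j)%R && (b j <= t)%R] :\ j1| <=
      #|[set j in Q | (a j1 <= a j)%R && (b j <= t)%R] :\ j1|)%N.
    apply: subset_leq_card; apply/fintype.subsetP => j.
    by rewrite !inE => /and4P[-> -> sj ->]; rewrite (le_trans (ltW as_)).
  apply: leq_trans (ut _ (lexx _)) _; apply: subset_leq_card.
  apply/fintype.subsetP => i; rewrite !inE => /and4P[-> iP xi xt]; rewrite iP xt !andbT.
  have [xb|xb] := leP (x i) (b j1).
    have : i \in [set i in P | (a j1 <= x i <= b j1)%R] by rewrite inE iP xi.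
    by move=> /minx; exact: le_trans.
  exact: le_trans (le_trans sx bi1) (ltW xb).
exists (fun j => if j == j1 then Some i1 else f j); split => [j jQ|j j' jQ j'Q].
  case: eqVneq => [->|jj1]; first by exists i1; rewrite ?i1P ?ai1.
  have [|i fi] := f1 j; first by rewrite !inE jj1.
  by rewrite inE => /andP[/andP[_ iP] xi]; exists i; rewrite ?iP.
case: eqVneq => [->|jj1]; case: eqVneq => [->|j'j1]//.
- have [|i -> /andP[+ _] [ii1]] := f1 j'; first by rewrite !inE j'j1.
  by rewrite !inE -ii1 eqxx.
- have [|i -> /andP[+ _] [ii1]] := f1 j; first by rewrite !inE jj1.
  by rewrite !inE -ii1 eqxx.
- by move=> ff; apply: f2; rewrite // !inE ?jj1 ?j'j1.
Qed.

Lemma interval_matching_perm (R : realFieldType) (I : finType) (x a b : I -> R) :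
    (forall j, a j <= b j) ->
    (forall s t : R, s <= t ->
      (#|[set j | (s <= a j)%R && (b j <= t)%R]| <= #|[set i | (s <= x i <= t)%R]|)%N) ->
  exists p : {perm I}, forall j, a j <= x (p j) <= b j.
Proof.
move=> ab count.
have [|f [f1 f2]] := @interval_matching _ _ _ x a b ab [set: I]%SET [set: I]%SET.
  by move=> s t /count; congr (_ <= _)%N; apply: eq_card => i; rewrite !inE.
have g j : {i | f j = Some i & a j <= x i <= b j}.
  case E : (f j) => [i|]; last by exfalso; have [//|i] := f1 j; rewrite E.
  by exists i => //; have [//|i'] := f1 j; rewrite E => -[<-] /andP[].
have gi : injective (fun j => s2val (g j)).
  by move=> j j' e; apply: f2 => //; rewrite (s2valP (g j)) (s2valP (g j')) e.
by exists (perm gi) => j; rewrite permE; exact: (s2valP' (g j)).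
Qed.

Local Open Scope classical_set_scope.
Local Open Scope ring_scope.

(** * Pencils of symmetric matrices *)

Lemma continuous_sumr (R : realType) (T : topologicalType) (I : Type) (r : seq I)
    (Q : pred I) (F : I -> T -> R) (x : T) : (forall i, Q i -> {for x, continuous (F i)}) ->
  {for x, continuous (fun y => \sum_(i <- r | Q i) F i y)}.
Proof. by move=> cF; apply: cvg_big => //; exact: add_continuous. Qed.

Section Pencil.
Context (R : realType).

Definition bform n (B : 'M[R]_n) (v w : 'rV[R]_n) : R := (v *m B *m w^T) 0 0.

Lemma formDl n (B : 'M[R]_n) u v w : bform B (u + v) w = bform B u w + bform B v w.
Proof. by rewrite /bform !mulmxDl mxE. Qed.

Lemma formDr n (B : 'M[R]_n) u v w : bform B u (v + w) = bform B u v + bform B u w.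
Proof. by rewrite /bform linearD/= mulmxDr mxE. Qed.

Lemma formZl n (B : 'M[R]_n) a v w : bform B (a *: v) w = a * bform B v w.
Proof. by rewrite /bform -!scalemxAl mxE. Qed.

Lemma formZr n (B : 'M[R]_n) a v w : bform B v (a *: w) = a * bform B v w.
Proof. by rewrite /bform linearZ/= -scalemxAr mxE. Qed.

Lemma formC n (B : 'M[R]_n) v w : B^T = B -> bform B v w = bform B w v.
Proof.
move=> Bs; rewrite /bform -[in LHS](trmxK (v *m B *m w^T)) mxE.
by rewrite !trmx_mul trmxK Bs mulmxA.
Qed.

Lemma form_sum n (B : 'M[R]_n) v w :
  bform B v w = \sum_i \sum_j v 0 i * B i j * w 0 j.
Proof.
rewrite /bform mxE; under eq_bigr do rewrite !mxE mulr_suml.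
by rewrite exchange_big.
Qed.

Lemma form_continuous n (B : 'M[R]_n) : continuous (fun v => bform B v v).
Proof.
move=> v; under eq_fun do rewrite form_sum.
apply: continuous_sumr => i _; apply: continuous_sumr => j _.
have cj : {for v, continuous (fun w : 'rV[R]_n => w 0 j)} by exact: coord_continuous.
have ci : {for v, continuous (fun w : 'rV[R]_n => w 0 i)} by exact: coord_continuous.
by apply: (cvgM _ cj); apply: (cvgM ci); exact: cvg_cst.
Qed.

Definition posdef n (B : 'M[R]_n) := forall v, v != 0 -> 0 < bform B v v.

(* A minimiser of the Rayleigh quotient is a generalised eigenvector. *)
Lemma pencil_eigenvector n (A L : 'M[R]_n.+1) : A^T = A -> L^T = L -> posdef L ->
  exists (v : 'rV[R]_n.+1) (mu : R), v != 0 /\ v *m A = mu *: (v *m L).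
Proof.
move=> As Ls Lp.
pose S := [set v : 'rV[R]_n.+1 | `|v| = 1].
pose f v := bform A v v / bform L v v.
have S0 : S !=set0.
  have d0 : (delta_mx 0 0 : 'rV[R]_n.+1) != 0.
    by apply/eqP => /matrixP/(_ 0 0); rewrite !mxE eqxx => /eqP; rewrite oner_eq0.
  exists (`|delta_mx 0 0 : 'rV[R]_n.+1|^-1 *: delta_mx 0 0); rewrite /S/=.
  by rewrite normrZ normfV normr_id mulVf// normr_eq0.
have Sn0 v : S v -> v != 0.
  by rewrite /S/=; apply: contraPneq => ->; rewrite normr0 => /eqP; rewrite eq_sym oner_eq0.
have cS : compact S.
  apply: bounded_closed_compact.
    by exists 1; split => // x x1 v; rewrite /S/= => ->; exact: ltW.
  rewrite (_ : S = (fun v : 'rV[R]_n.+1 => `|v|) @^-1` [set 1])//.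
  apply: preimage_closed; last exact: closed_eq.
  by move=> v _; exact: norm_continuous.
have [v vS vmin] : exists2 c, c \in S & forall t, t \in S -> f c <= f t.
  apply: EVT_min_rV => //; apply: continuous_in_subspaceT => v vS.
  have Lv0 : bform L v v != 0 by rewrite gt_eqF// Lp// Sn0//; move: vS; rewrite inE.
  exact: (cvgM (@form_continuous _ A v) (cvgV Lv0 (@form_continuous _ L v))).
rewrite inE in vS; have v0 := Sn0 _ vS; have Lv := Lp _ v0.
exists v, (f v); split => //.
(* By minimality the form of [B] is nonnegative, and it vanishes at v; such a v lies in the kernel
   of [B]. *)
pose B := A - f v *: L.
have Bs : B^T = B by rewrite /B linearB/= linearZ/= As Ls.
have BE u w : bform B u w = bform A u w - f v * bform L u w.
  by rewrite /bform /B mulmxBr mulmxBl mxE -scalemxAr -scalemxAl !mxE.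
have B0 : bform B v v = 0 by rewrite BE /f mulfVK ?subrr// gt_eqF.
have Bp w : 0 <= bform B w w.
  have [->|w0] := eqVneq w 0; first by rewrite /bform !mul0mx mxE.
  have nw : `|w| != 0 by rewrite normr_eq0.
  have := vmin (`|w|^-1 *: w); rewrite inE /S/= normrZ normfV normr_id mulVf//.
  move=> /(_ erefl); rewrite [X in _ <= X]/f !formZl !formZr.
  have -> : `|w|^-1 * (`|w|^-1 * bform A w w) / (`|w|^-1 * (`|w|^-1 * bform L w w)) =
    bform A w w / bform L w w by field; rewrite nw gt_eqF ?Lp.
  by rewrite ler_pdivlMr ?Lp// BE subr_ge0.
have Bvw w : bform B v w = 0.
  have H t : 0 <= 2 * t * bform B v w + t ^+ 2 * bform B w w.
    have := Bp (v + t *: w); rewrite formDl !formDr !formZl !formZr B0 (formC w v Bs).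
    by move=> h; apply: le_trans h _; rewrite le_eqVlt; apply/orP; left; apply/eqP; ring.
  set b := bform B v w in H *; set c := bform B w w in H; have c0 : 0 <= c := Bp w.
  have c1 : 0 < c + 1 by rewrite ltr_wpDl.
  (* The minimiser -b/c of the quadratic is replaced by -b/(c + 1), which is meaningful for c = 0
     too. The value there is still negative unless b = 0. *)
  have := H (- b / (c + 1)).
  have -> : 2 * (- b / (c + 1)) * b + (- b / (c + 1)) ^+ 2 * c =
    - (b ^+ 2 * (c + 2) / (c + 1) ^+ 2) by field; rewrite gt_eqF.
  rewrite oppr_ge0 pmulr_lle0 ?invr_gt0 ?exprn_gt0// pmulr_lle0 ?ltr_wpDl// => b0.
  by apply/eqP; rewrite -sqrf_eq0 eq_le b0 sqr_ge0.
apply/eqP; rewrite -subr_eq0; apply/eqP/rowP => j; rewrite [RHS]mxE.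
have := Bvw (delta_mx 0 j); rewrite /bform trmx_delta -colE mxE /B.
by rewrite mulmxBr -scalemxAr.
Qed.

(** An eigenvector v, normalised for L, is split off. Since v A is a multiple of v L, the
    L-orthogonal complement of v, spanned by the rows of [Q], is also A-orthogonal to v, and both
    matrices become block diagonal. *)
Lemma pencil_diagonalisation n (A L : 'M[R]_n) : A^T = A -> L^T = L -> posdef L ->
  exists (P : 'M[R]_n) (d : 'rV[R]_n), P *m L *m P^T = 1%:M /\ P *m A *m P^T = diag_mx d.
Proof.
elim: n => [|n IH] in A L * => As Ls Lp.
  by exists 0, 0; split; apply/matrixP => -[].
have [v0 [mu [v0n0 v0A]]] := pencil_eigenvector As Ls Lp.
pose v := (Num.sqrt (bform L v0 v0))^-1 *: v0.
have sn0 : Num.sqrt (bform L v0 v0) != 0 by rewrite gt_eqF// sqrtr_gt0 Lp.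
have vL : v *m L *m v^T = 1%:M.
  rewrite [LHS]mx11_scalar -[X in X%:M]/(bform L v v) formZl formZr.
  by rewrite mulrA -invfM -expr2 sqr_sqrtr ?ltW ?Lp// mulVf// gt_eqF ?Lp.
have vA : v *m A = mu *: (v *m L) by rewrite -!scalemxAl v0A !scalerA mulrC.
have rW : \rank (kermx (L *m v^T)) = n.
  rewrite mxrank_ker; suff -> : \rank (L *m v^T) = 1%N by rewrite subn1.
  apply/eqP; rewrite eqn_leq rank_leq_col lt0n mxrank_eq0.
  apply/eqP => Lv0; move: vL; rewrite -mulmxA Lv0 mulmx0 => /matrixP/(_ 0 0).
  by rewrite !mxE eqxx => /eqP; rewrite eq_sym oner_eq0.
pose Q : 'M[R]_(n, n.+1) := castmx (rW, erefl) (row_base (kermx (L *m v^T))).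
have Qfree : row_free Q by rewrite /row_free eqmx_cast eq_row_base rW.
have QLv : Q *m L *m v^T = 0.
  apply/sub_kermxP; rewrite sub_kermx -mulmxA -sub_kermx.
  by rewrite eqmx_cast eq_row_base.
have vLQ : v *m L *m Q^T = 0.
  by apply: trmx_inj; rewrite !trmx_mul trmxK Ls mulmxA QLv trmx0.
have vAQ : v *m A *m Q^T = 0 by rewrite vA -scalemxAl vLQ scaler0.
have QAv : Q *m A *m v^T = 0.
  by apply: trmx_inj; rewrite !trmx_mul trmxK As mulmxA vAQ trmx0.
have sym B : B^T = B -> (Q *m B *m Q^T)^T = Q *m B *m Q^T.
  by move=> Bs; rewrite !trmx_mul trmxK Bs mulmxA.
have [|P [d [PL PA]]] := IH _ _ (sym A As) (sym L Ls).
  move=> w w0; have : w *m Q != 0.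
    by apply: contra_neq w0 => wQ; apply: (row_free_inj Qfree); rewrite wQ mul0mx.
  by move=> /Lp; rewrite /bform trmx_mul !mulmxA.
have blk B : col_mx v (P *m Q) *m B *m (col_mx v (P *m Q))^T =
    block_mx (v *m B *m v^T) (v *m B *m Q^T *m P^T)
             (P *m (Q *m B *m v^T)) (P *m (Q *m B *m Q^T) *m P^T).
  by rewrite mul_col_mx tr_col_mx mul_col_row trmx_mul !mulmxA.
exists (col_mx v (P *m Q)), (row_mx mu%:M d); split.
  by rewrite blk vL vLQ QLv PL mulmx0 mul0mx -scalar_mx_block.
rewrite blk vAQ vA -scalemxAl vL QAv PA mulmx0 mul0mx.
have D2 : diag_mx (row_mx (mu%:M : 'rV[R]_1) d) = block_mx (diag_mx mu%:M) 0 0 (diag_mx d).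
  exact: diag_mx_row.
have D3 : mu *: 1%:M = diag_mx (mu%:M : 'rV[R]_1).
  by apply/matrixP => i j; rewrite !mxE !ord1 eqxx mulr1 mulr1n.
by rewrite [RHS]D2 -D3.
Qed.

Lemma form_mul m n (B : 'M[R]_n) (P : 'M[R]_(m, n)) v w :
  bform B (v *m P) (w *m P) = bform (P *m B *m P^T) v w.
Proof. by rewrite /bform trmx_mul !mulmxA. Qed.

Lemma form_diag n (d : 'rV[R]_n) v w :
  bform (diag_mx d) v w = \sum_i d 0 i * v 0 i * w 0 i.
Proof.
rewrite /bform mxE; apply: eq_bigr => i _.
by rewrite mul_mx_diag !mxE; congr (_ * _); rewrite mulrC.
Qed.

(* If fewer than #|J| eigenvalues were r-close to kap, some nonzero v
   supported on J would have no component along the r-close eigenvectors; then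
   w, obtained from v by giving its i-th component the sign of d_i - kap,
   violates the hypothesis. *)
Lemma pencil_count n (A L P : 'M[R]_n) (d : 'rV[R]_n) (kap r : R) (J : {set 'I_n}) :
    P *m L *m P^T = 1%:M -> P *m A *m P^T = diag_mx d ->
    (forall v w : 'rV[R]_n, (forall j, j \notin J -> v 0 j = 0) ->
      2 * (bform A v w - kap * bform L v w) <= r * (bform L v v + bform L w w)) ->
  (#|J| <= #|[set i | (`|d 0 i - kap| <= r)%R]%SET|)%N.
Proof.
move=> PL PA H; set S := [set i | _]%SET; rewrite leqNgt; apply/negP => SJ.
have Pu : P \in unitmx by move: PL; rewrite -mulmxA => /mulmx1_unit[].
(* Each row of [B] holds the components of one unit vector of [J] along the r-close eigenvectors.
   There are more rows than columns, so some nonzero u satisfies u B = 0. *)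
pose B : 'M[R]_(#|J|, #|S|) :=
  \matrix_(a, b) invmx P (enum_val a) (enum_val b).
have /rowV0Pn[u uB u0] : kermx B != 0.
  rewrite kermx_eq0 /row_free neq_ltn; apply/orP; left.
  by apply: leq_ltn_trans SJ; exact: rank_leq_col.
move: uB => /sub_kermxP uB.
pose E : 'M[R]_(#|J|, n) := \matrix_(a, j) (enum_val a == j)%:R.
pose v := u *m E; pose y := v *m invmx P.
have vE a : v 0 (enum_val a) = u 0 a.
  rewrite mxE (bigD1 a)//= mxE eqxx mulr1 big1 ?addr0// => b ba.
  by rewrite mxE (inj_eq enum_val_inj) (negbTE ba) mulr0.
have y0 : y != 0.
  apply: contra_neq u0 => y0; apply/rowP => a; rewrite -vE.
  by rewrite -(mulmxKV Pu v) -/y y0 mul0mx !mxE.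
have yS i : i \in S -> y 0 i = 0.
  move=> iS; have uBi : (u *m B) 0 (enum_rank_in iS i) = 0 by rewrite uB mxE.
  rewrite mxE in uBi.
  rewrite /y /v -mulmxA mxE -[RHS]uBi; apply: eq_bigr => a _; congr (_ * _).
  rewrite !mxE enum_rankK_in// (bigD1 (enum_val a))//= mxE eqxx mul1r.
  rewrite big1 ?addr0// => j jE.
  by rewrite mxE eq_sym (negbTE jE) mul0r.
pose z : 'rV[R]_n := \row_i (Num.sg (d 0 i - kap) * y 0 i).
have vy : v = y *m P by rewrite mulmxKV.
have formL a b : bform L (a *m P) (b *m P) = \sum_i a 0 i * b 0 i.
  rewrite form_mul PL -diag_const_mx form_diag; apply: eq_bigr => i _.
  by rewrite mxE mul1r.
have formA a b : bform A (a *m P) (b *m P) = \sum_i d 0 i * a 0 i * b 0 i.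
  by rewrite form_mul PA form_diag.
have := H v (z *m P).
rewrite vy formA !formL => /(_ _)/[dup] h.
have {}h : 2 * (\sum_i d 0 i * y 0 i * z 0 i - kap * (\sum_i y 0 i * z 0 i)) <=
    r * (\sum_i y 0 i * y 0 i + \sum_i z 0 i * z 0 i).
  apply: h => j jJ; rewrite -vy mxE big1// => a _; rewrite mxE.
  case: eqP => [aj|]; last by rewrite mulr0.
  by move: jJ; rewrite -aj enum_valP.
have {}h : 0 <= \sum_i (r * (y 0 i * y 0 i + z 0 i * z 0 i) -
    2 * (d 0 i * y 0 i * z 0 i - kap * (y 0 i * z 0 i))).
  by rewrite sumrB -!mulr_sumr big_split sumrB -mulr_sumr subr_ge0.
have [i0 yi0] : exists i, y 0 i != 0.
  by apply/existsP; apply: contraR y0 => /existsPn yi; apply/eqP/rowP => i;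
    rewrite [RHS]mxE; apply/eqP; rewrite -[_ == _]negbK.
pose t i := r * (y 0 i * y 0 i + z 0 i * z 0 i) -
  2 * (d 0 i * y 0 i * z 0 i - kap * (y 0 i * z 0 i)).
have t_lt0 i : y 0 i != 0 -> t i < 0.
  move=> yi; have iS : i \notin S by apply: contra yi => /yS ->.
  have zi : z 0 i = Num.sg (d 0 i - kap) * y 0 i by rewrite mxE.
  move: iS; rewrite inE -ltNge /t zi => rs; set s := d 0 i - kap in rs *.
  have y2 : 0 < y 0 i ^+ 2 by rewrite exprn_even_gt0.
  have -> : r * (y 0 i * y 0 i + Num.sg s * y 0 i * (Num.sg s * y 0 i)) -
      2 * (d 0 i * y 0 i * (Num.sg s * y 0 i) - kap * (y 0 i * (Num.sg s * y 0 i))) =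
      (r * (1 + Num.sg s ^+ 2) - 2 * `|s|) * y 0 i ^+ 2.
    by rewrite normrEsg /s; ring.
  rewrite pmulr_llt0// sqr_sg; have [s0|s0] := eqVneq s 0.
    by move: rs; rewrite s0 normr0/=; lra.
  by rewrite /=; lra.
have t_le0 i : t i <= 0.
  have [y_0|/t_lt0/ltW//] := eqVneq (y 0 i) 0.
  have zi : z 0 i = Num.sg (d 0 i - kap) * y 0 i by rewrite mxE.
  by rewrite /t zi y_0 !(mulr0, mul0r) addr0 subr0 !mulr0 subr0.
suff : \sum_i t i < 0 by rewrite ltNge h.
rewrite (bigD1 i0)//= -[ltRHS]addr0; apply: ltr_leD; first exact: t_lt0.
apply: (@le_trans _ _ (\sum_(i < n | i != i0) 0)); last by rewrite big1.
by apply: ler_sum => i _; exact: t_le0.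
Qed.

Lemma char_poly_conj n (B P : 'M[R]_n) : P \in unitmx ->
  char_poly (P *m B *m invmx P) = char_poly B.
Proof.
move=> Pu; rewrite /char_poly /char_poly_mx.
have PK : map_mx polyC P *m map_mx polyC (invmx P) = 1%:M.
  by rewrite -map_mxM mulmxV// map_mx1.
have -> : 'X%:M - map_mx polyC (P *m B *m invmx P) =
    map_mx polyC P *m ('X%:M - map_mx polyC B) *m map_mx polyC (invmx P).
  rewrite mulmxBr mulmxBl !map_mxM; congr (_ - _).
  by rewrite scalar_mxC -mulmxA PK mulmx1.
rewrite !det_mulmx mulrC mulrA -det_mulmx.
by rewrite -map_mxM mulVmx// map_mx1 det1 mul1r.
Qed.

(** P L P^T = 1 gives L^-1 = P^T P, so L^-1 A = P^T (P A P^T) P^-T is conjugate to the diagonal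
    matrix. *)
Lemma char_poly_pencil n (A L P : 'M[R]_n) (d : 'rV[R]_n) :
    P *m L *m P^T = 1%:M -> P *m A *m P^T = diag_mx d ->
  char_poly (invmx L *m A) = \prod_i ('X - (d 0 i)%:P).
Proof.
move=> PL PA.
have Pu : P \in unitmx by move: PL; rewrite -mulmxA => /mulmx1_unit[].
have PTu : P^T \in unitmx by rewrite unitmx_tr.
have LP : L *m (P^T *m P) = 1%:M.
  rewrite mulmxA; apply: (can_inj (mulKmx Pu)).
  by rewrite mulmxA !mulmxA PL mul1mx mulmx1.
have Lu : L \in unitmx by case/mulmx1_unit: LP.
have -> : invmx L *m A = P^T *m diag_mx d *m invmx P^T.
  by rewrite -PA mulmxA mulmxK// -[invmx L]mulmx1 -LP mulKmx// !mulmxA.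
rewrite char_poly_conj// char_poly_trig ?diag_mx_is_trig//.
by apply: eq_bigr => i _; rewrite mxE eqxx mulr1n.
Qed.

(** A product of monic linear factors determines its roots with multiplicity. Counts and signs thus
    pass from the [d] of a diagonalisation to any [lam], which is known through the characteristic
    polynomial alone. *)
Lemma prod_XsubC_card n (x y : 'I_n -> R) (Q : pred R) :
  \prod_i ('X - (x i)%:P) = \prod_i ('X - (y i)%:P) ->
  #|[set i | Q (x i)]%SET| = #|[set i | Q (y i)]%SET|.
Proof.
move=> xy; have cE (z : 'I_n -> R) : #|[set i | Q (z i)]%SET| = count Q (codom z).
  rewrite cardsE cardE size_filter /codom /image_mem count_map.
  by rewrite enumT; apply: eq_count => i.
rewrite !cE; apply/seq.permP; apply: prod_XsubC_eq.
by rewrite !big_image.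
Qed.

Lemma sorted_spectrum n (d : 'I_n -> R) :
  exists lam : 'I_n -> R, {homo lam : i j / (i <= j)%N >-> i <= j} /\
  \prod_i ('X - (d i)%:P) = \prod_i ('X - (lam i)%:P).
Proof.
pose s := sort <=%R (codom d).
have ss : size s = n by rewrite size_sort size_codom card_ord.
exists (fun i => s`_i); split => [i j ij|].
  by apply: (sorted_leq_nth le_trans le_refl) => //;
    rewrite ?sort_le_sorted ?inE ?ss.
rewrite -(big_mkord xpredT (fun i => 'X - (s`_i)%:P)) -[in RHS]ss.
rewrite -(big_nth 0 xpredT (fun c => 'X - c%:P)).
rewrite (perm_big (codom d)) ?perm_sort//=.
by rewrite /codom /image_mem big_map big_enum.
Qed.

End Pencil.

(** * Lebesgue measure on R^d *)

Section BoxVolume.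
Context (R : realType).
Local Notation mu := (@lebesgue_measure R).

(* Induction on the dimension: integrate the covering inequality of the
   slices over the first coordinate.  The predicate Q selects the boxes that
   meet the current slice. *)
Lemma box_cover_le n (a b : 'I_n -> R) (c d : nat -> 'I_n -> R) (Q : nat -> bool) :
    (forall i, a i <= b i) ->
    (forall x : 'I_n -> R, (forall i, a i <= x i <= b i) ->
      exists2 k, Q k & forall i, c k i <= x i <= d k i) ->
  ((\prod_i (b i - a i))%:E <=
   \sum_(k <oo) (if Q k then \prod_i Num.max 0 (d k i - c k i) else 0)%:E)%E.
Proof.
elim: n => [|n IH] in a b c d Q *.
  (* In dimension 0 all products are 1, and covering the only point provides a selected box. *)
  move=> _ /(_ a)[[]//|k Qk _].
  apply: le_trans (nneseries_lim_ge k.+1 _); last first.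
    by move=> m _ _; rewrite lee_fin; case: ifP => // _; rewrite big_ord0.
  rewrite big_nat_recr//= Qk !big_ord0 leeDr//; apply: sume_ge0 => m _.
  by rewrite lee_fin; case: ifP => // _; rewrite big_ord0.
move=> ab cover.
pose V (k : nat) : R := if Q k then \prod_i Num.max 0 (d k (lift ord0 i) - c k (lift ord0 i)) else 0.
have V0 k : 0 <= V k.
  by rewrite /V; case: ifP => // _; apply: prodr_ge0 => i _; rewrite le_max lexx.
pose J k := `[c k ord0, d k ord0]%classic.
pose D := `[a ord0, b ord0]%classic.
pose f (k : nat) (x : measurableTypeR R) : \bar R := ((V k * \1_(J k) x)%R : R)%:E.
have mD : measurable (D : set (measurableTypeR R)) by exact: measurable_itv.
have mJ k : measurable (J k : set (measurableTypeR R)) by exact: measurable_itv.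
have f0 k x : (0 <= f k x)%E by rewrite lee_fin mulr_ge0.
have mf k : measurable_fun (D : set (measurableTypeR R)) (f k).
  apply/measurable_EFinP; apply: measurable_funM.
    exact: measurable_cst.
  exact: measurable_indic.
have slice x : D x ->
    ((\prod_(i < n) (b (lift ord0 i) - a (lift ord0 i)))%:E <= \sum_(k <oo) f k x)%E.
  move=> Dx.
  have H := IH (fun i => a (lift ord0 i)) (fun i => b (lift ord0 i))
     (fun k i => c k (lift ord0 i)) (fun k i => d k (lift ord0 i))
     (fun k => Q k && (x \in J k)).
  apply: le_trans (H _ _) _ => [i||]; first exact: ab.
    move=> y yab.
    (* The point with first coordinate x and remaining coordinates y. *)
    have [i|k Qk yk] := cover (fun i => oapp y x (unlift ord0 i)).
      by case: unliftP => [j|] ->//=; move: Dx; rewrite /D/= in_itv.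
    exists k.
      have := yk ord0; rewrite unlift_none/= => xJ; rewrite Qk/= inE /J/=.
      by rewrite in_itv.
    by move=> i; have := yk (lift ord0 i); rewrite liftK.
  apply: lee_nneseries => k _.
    by move=> _; rewrite lee_fin; case: ifP => // _; apply: prodr_ge0 => i _; rewrite le_max lexx.
  rewrite lee_fin /V indicE; case: (Q k) => /=; last by rewrite mul0r.
  by case: (x \in J k); rewrite ?mulr1 ?mulr0.
have sumf : (\int[mu]_(x in D) \sum_(k <oo) f k x =
    \sum_(k <oo) \int[mu]_(x in D) f k x)%E.
  by apply: integral_nneseries => // k x _; exact: f0.
have muD : mu D = (b ord0 - a ord0)%:E.
  rewrite lebesgue_measure_itv/= lte_fin; case: ltP => [_|ba]; first by rewrite -EFinB.
  by rewrite (@le_anti _ _ (a ord0) (b ord0)) ?subrr ?ab.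
have -> : (\prod_i (b i - a i))%:E =
    (\int[mu]_(x in D) (cst (\prod_(i < n) (b (lift ord0 i) - a (lift ord0 i)))%:E) x)%E.
  by rewrite integral_cst//= [X in (_ * X)%E]muD big_ord_recl -EFinM mulrC.
apply: le_trans (_ : (\int[mu]_(x in D) (\sum_(k <oo) f k x) <= _)%E).
  apply: ge0_le_integral => //.
  - by move=> x _; rewrite lee_fin; apply: prodr_ge0 => i _; rewrite subr_ge0 ab.
  - by apply: ge0_emeasurable_sum.
rewrite sumf; apply: lee_nneseries => [k _ _|k _]; first exact: integral_ge0.
have -> : (\int[mu]_(x in D) f k x = (V k)%:E * mu (J k `&` D))%E.
  rewrite -(integral_indic mu mD (mJ k)) -ge0_integralZl ?lee_fin//.
  by apply/measurable_EFinP; exact: measurable_indic.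
apply: (@le_trans _ _ ((V k)%:E * mu (J k))%E).
  apply: lee_wpmul2l; first by rewrite lee_fin.
  by apply: le_measure; rewrite ?inE//; exact: measurableI.
rewrite lebesgue_measure_itv/= lte_fin /V.
case: (Q k); rewrite ?mul0e// big_ord_recl.
case: ltP => cd; last first.
  rewrite mule0 lee_fin mulr_ge0 ?le_max ?lexx//.
  by apply: prodr_ge0 => i _; rewrite le_max lexx.
rewrite -EFinB -EFinM lee_fin mulrC max_r; first exact: lexx.
by rewrite subr_ge0 ltW.
Qed.

End BoxVolume.

Section LebesgueOuter.
Context (R : realType) (n : nat).
Local Notation E := ('rV[R]_n.+1).
Local Notation mu := (@lebesgue_outer R n).
Implicit Types (A : set E) (c : E * E).

(** The half of the measure of a box that is not immediate from the definition; it keeps nonempty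
    open sets from being null. *)
Lemma box_volume_le_outer c A : (forall i, c.1 0 i <= c.2 0 i) -> box c `<=` A ->
  ((box_volume c)%:E <= mu A)%E.
Proof.
move=> c12 cA; apply: le_ereal_inf_tmp => _ [s As <-].
have -> : box_volume c = \prod_i (c.2 0 i - c.1 0 i).
  by apply: eq_bigr => i _; rewrite (max_idPr _)// subr_ge0.
apply: (@box_cover_le R n.+1 (fun i => c.1 0 i) (fun i => c.2 0 i)
  (fun k i => (s k).1 0 i) (fun k i => (s k).2 0 i) xpredT) => // x xc.
have [|k _ kx] := As (\row_i x i); first by apply: cA => i; rewrite mxE.
by exists k => // i; have := kx i; rewrite mxE.
Qed.

Lemma outer_box_le c A : A `<=` box c -> (mu A <= (box_volume c)%:E)%E.
Proof.
move=> Ac; apply: ereal_inf_lbound.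
(* The single box is padded to a sequence by a degenerate one, of volume 0 because there is at least
   one coordinate. *)
exists (fun k : nat => if k == 0%N then c else ((0, 0) : E * E)) => /=.
  by move=> x /Ac xc; exists 0%N.
rewrite (@nneseries_split _ _ 0 1)//; last first.
  by move=> k _; rewrite lee_fin box_volume_ge0.
rewrite add0n big_nat1 eseries0 ?adde0// => -[//|k] _ _.
by rewrite /box_volume (bigD1 ord0)//= !mxE subrr maxxx mul0r.
Qed.

Lemma outer_bounded_lty A : bounded_set A -> (mu A < +oo)%E.
Proof.
move=> /pinfty_ex_gt0[M M0 AM].
pose c : E * E := (const_mx (- M), const_mx M).
apply: (@le_lt_trans _ _ (box_volume c)%:E); last exact: ltry.
apply: outer_box_le => x /AM xM i; rewrite !mxE -ler_norml.
by apply: le_trans xM; rewrite [leRHS]/Num.Def.normr/= mx_normrE; apply/bigmax_geP; right; exists (0, i).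
Qed.

(** A homothety of positive ratio sends boxes to boxes and multiplies volumes by s^(n+1), so it
    carries coverings of A to coverings of the image. *)
Lemma outer_homothety A (v : E) (s : R) : 0 < s ->
  (mu ((fun x => v + s *: x)%R @` A) <= (s ^+ n.+1)%:E * mu A)%E.
Proof.
move=> s0; have sn0 : 0 < s ^+ n.+1 by rewrite exprn_gt0.
rewrite -lee_pdivrMl//; apply: le_ereal_inf_tmp => _ [c Ac <-].
rewrite lee_pdivrMl// -nneseriesZl; last by move=> *; rewrite lee_fin box_volume_ge0.
apply: ereal_inf_lbound; exists (fun k => (v + s *: (c k).1, v + s *: (c k).2)) => /=.
  move=> _ [x /Ac[k _ xk] <-]; exists k => // i; have /andP[h1 h2] := xk i.
  by rewrite !mxE !lerD2l !ler_pM2l// h1.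
apply: eq_eseriesr => k _; rewrite -EFinM; congr EFin.
have -> : s ^+ n.+1 = \prod_(i < n.+1) s by rewrite prodr_const card_ord.
rewrite /box_volume -big_split/=.
apply: eq_bigr => i _; rewrite !mxE -[X in Num.max X]/0 maxr_pMr ?ltW// mulr0.
by congr Num.max; ring.
Qed.

(** The hyperplane cuts each box of a covering in two boxes whose volumes add up, and the pieces
    cover the two parts of the covered set. *)
Lemma caratheodory_halfspace (i : 'I_n.+1) (t : R) :
  mu.-caratheodory [set x : E | x 0 i <= t].
Proof.
apply: le_caratheodory_measurable => X.
apply: le_ereal_inf_tmp => _ [c Xc <-].
(* Only the i-th side is clipped at t. A piece may be empty; its side is then negative or 0 and
   counts as 0 in the volume. *)
pose lo k : E * E := ((c k).1, \row_j if j == i then Num.min ((c k).2 0 j) t else (c k).2 0 j).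
pose hi k : E * E := (\row_j if j == i then Num.max ((c k).1 0 j) t else (c k).1 0 j, (c k).2).
have volE k : box_volume (c k) = box_volume (lo k) + box_volume (hi k).
  rewrite /box_volume (bigD1 i)//= [in RHS](bigD1 i)//= [X in _ = _ + X](bigD1 i)//=.
  rewrite !mxE eqxx.
  have Eq1 : \prod_(j < n.+1 | j != i) Num.max 0 ((lo k).2 0 j - (lo k).1 0 j) =
      \prod_(j < n.+1 | j != i) Num.max 0 ((c k).2 0 j - (c k).1 0 j).
    by apply: eq_bigr => j ji; rewrite /lo/= mxE (negbTE ji).
  have Eq2 : \prod_(j < n.+1 | j != i) Num.max 0 ((hi k).2 0 j - (hi k).1 0 j) =
      \prod_(j < n.+1 | j != i) Num.max 0 ((c k).2 0 j - (c k).1 0 j).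
    by apply: eq_bigr => j ji; rewrite /hi/= mxE (negbTE ji).
  rewrite Eq1 Eq2 -mulrDl; congr (_ * _).
  set p := (c k).1 0 i; set q := (c k).2 0 i.
  have [qt|/ltW tq] := leP q t.
    by rewrite [Num.max 0 (q - Num.max p t)]max_l ?addr0// subr_le0 le_max qt orbT.
  have [pt|/ltW tp] := leP p t.
    by rewrite !max_r ?subr_ge0 ?(le_trans pt tq)//; ring.
  by rewrite [Num.max 0 (t - p)]max_l ?add0r// subr_le0.
have -> : (\sum_(k <oo) (box_volume (c k))%:E =
    \sum_(k <oo) (box_volume (lo k))%:E + \sum_(k <oo) (box_volume (hi k))%:E)%E.
  rewrite -nneseriesD; try by move=> *; rewrite lee_fin box_volume_ge0.
  by apply: eq_eseriesr => k _; rewrite volE.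
apply: leeD; apply: ereal_inf_lbound.
  exists lo => // x [/Xc[k _ xk] /= xt]; exists k => // j.
  have /andP[h1 h2] := xk j; rewrite !mxE h1/=; case: eqP => [ji|//].
  by rewrite le_min h2 ji.
exists hi => // x [/Xc[k _ xk] /= /negP]; rewrite -ltNge => xt; exists k => // j.
have /andP[h1 h2] := xk j; rewrite !mxE h2 andbT/=; case: eqP => [ji|//].
by rewrite ge_max h1 ji ltW.
Qed.

End LebesgueOuter.

Section OpenMeasurable.
Context (R : realType) (n : nat).
Local Notation E := ('rV[R]_n.+1).
Local Notation mu := (@lebesgue_outer R n).
Local Notation EC := (caratheodory_type (@lebesgue_outer R n)).
Implicit Types (A : set E).

Lemma caratheodory_hbox (a b : 'I_n.+1 -> R) :
  mu.-caratheodory [set x : E | forall i, a i < x 0 i <= b i].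
Proof.
have -> : [set x : E | forall i, a i < x 0 i <= b i] =
    \bigcap_(i in [set: 'I_n.+1]) ([set x : E | x 0 i <= b i] `\` [set x : E | x 0 i <= a i]).
  apply/seteqP; split => [x xab i _|x xab i].
    by have /andP[h1 h2] := xab i; split => //=; apply/negP; rewrite -ltNge.
  by have [h1 /= /negP h2] := xab i I; rewrite ltNge h2.
apply: (@fin_bigcap_measurable _ EC) => [|i _]; first exact: finite_finset.
by apply: caratheodory_measurable_setD; exact: caratheodory_halfspace.
Qed.

Lemma rV_ballP (x : E) (P : set E) : nbhs x P ->
  exists2 e : R, 0 < e & forall y : E, (forall i, `|x 0 i - y 0 i| < e) -> P y.
Proof.
move=> /nbhs_ballP[e /= e0 xP]; exists e => // y xy; apply: xP.
by split => // i j; rewrite ord1; exact: xy.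
Qed.

(** An open set is the union of the countably many half-open boxes with rational corners that it
    contains. *)
Lemma open_caratheodory A : open A -> mu.-caratheodory A.
Proof.
move=> oA.
pose H (pq : 'rV[rat]_n.+1 * 'rV[rat]_n.+1) :=
  [set x : E | forall i, ratr (pq.1 0 i) < x 0 i <= ratr (pq.2 0 i)].
pose F k := if unpickle k is Some pq then
  if `[< H pq `<=` A >] then H pq else set0 else set0.
have -> : A = \bigcup_k F k.
  apply/seteqP; split => [x Ax|x [k _]]; last first.
    by rewrite /F; case: (unpickle k) => // pq; case: asboolP => // HA /HA.
  have [e e0 eA] := rV_ballP (open_nbhs_nbhs (conj oA Ax)).
  have lt1 i : x 0 i - e < x 0 i by rewrite ltrBlDr ltrDl.
  have lt2 i : x 0 i < x 0 i + e by rewrite ltrDl.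
  pose p := \row_i sval (cid (rat_in_itvoo (lt1 i))).
  pose q := \row_i sval (cid (rat_in_itvoo (lt2 i))).
  have pP i : x 0 i - e < ratr (p 0 i) < x 0 i.
    by rewrite mxE; case: cid => r /=; rewrite in_itv.
  have qP i : x 0 i < ratr (q 0 i) < x 0 i + e.
    by rewrite mxE; case: cid => r /=; rewrite in_itv.
  have HA : H (p, q) `<=` A.
    move=> y /= ypq; apply: eA => i; rewrite ltr_norml.
    have /andP[p1 p2] := pP i; have /andP[q1 q2] := qP i; have /andP[y1 y2] := ypq i.
    by apply/andP; split; lra.
  exists (pickle (p, q)) => //; rewrite /F pickleK; case: asboolP => //= _ i.
  by have /andP[_ ->] := pP i; have /andP[/ltW -> _] := qP i.
apply: caratheodory_measurable_bigcup => k; rewrite /F.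
case: (unpickle k) => [pq|]; last exact: caratheodory_measurable_set0.
case: asboolP => _; last exact: caratheodory_measurable_set0.
exact: caratheodory_hbox.
Qed.

Lemma closed_caratheodory A : closed A -> mu.-caratheodory A.
Proof.
move=> cA; rewrite -[A]setCK; apply: caratheodory_measurable_setC.
by apply: open_caratheodory; exact: closed_openC.
Qed.

Lemma outer0_caratheodory A : mu A = 0%E -> mu.-caratheodory A.
Proof.
move=> A0; apply: le_caratheodory_measurable => X.
rewrite [X in (X + _ <= _)%E](_ : _ = 0%E) ?add0e; first exact: le_outer_measure.
by apply/eqP; rewrite eq_le outer_measure_ge0 andbT -A0; apply: le_outer_measure.
Qed.

Lemma continuous_measurable (f : E -> R) (D : set EC) :
  continuous f -> measurable_fun D (f : EC -> R).
Proof.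
move=> cf; apply: (@measurable_funS _ _ _ _ setT) => //.
apply: (measurability _ (RGenOInfty.measurableE R)) => _ [_ [r ->] <-].
rewrite setTI; apply: open_caratheodory; apply: open_comp; last exact: interval_open.
by move=> x _; exact: cf.
Qed.

Lemma open_outer_gt0 A : open A -> A !=set0 -> (0 < mu A)%E.
Proof.
move=> oA [x Ax]; have [e e0 eA] := rV_ballP (open_nbhs_nbhs (conj oA Ax)).
pose c : E * E := (x, \row_i (x 0 i + e / 2)).
apply: (@lt_le_trans _ _ (box_volume c)%:E).
  rewrite lte_fin; apply: prodr_gt0 => i _; rewrite /c/= mxE.
  by rewrite lt_max; apply/orP; right; lra.
apply: box_volume_le_outer => [i|y yc]; first by rewrite /= mxE; lra.
apply: eA => i; have := yc i; rewrite /= mxE => /andP[h1 h2].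
by rewrite ltr_norml; apply/andP; split; lra.
Qed.

(* K lies in the dilation by 1/s, 0 < s < 1, of its interior about an interior
   point; let s tend to 1. *)
Lemma convex_boundary_null (K : set E) : closed K -> bounded_set K ->
    (forall x y (t : R), K x -> K y -> 0 <= t <= 1 -> K ((1 - t) *: x + t *: y)) ->
    K° !=set0 ->
  mu (K `\` K°) = 0%E.
Proof.
move=> clK bK cvxK [x0 x0K].
have mK := closed_caratheodory clK.
have oI : open K° by exact: open_interior.
have mI := open_caratheodory oI.
have IK : K° `<=` K by exact: interior_subset.
have bI : bounded_set K° by move: bK => [C [Cr bC]]; exists C; split => // x /bC h y /IK /h.
have Kfin := outer_bounded_lty bK; have Ifin := outer_bounded_lty bI.
have KE : mu K = (mu K° + mu (K `\` K°))%E.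
  by rewrite setDE -[X in (mu X + _)%E](setIidr IK); exact: mI.
have [e e0 eK] := rV_ballP x0K.
have shrink s x : 0 < s < 1 -> K x -> K° (x0 + s *: (x - x0)).
  move=> /andP[s0 s1] Kx; set z := x0 + s *: (x - x0).
  have s1' : 0 < 1 - s by rewrite subr_gt0.
  apply/nbhs_ballP; exists ((1 - s) * e) => /=; first exact: mulr_gt0.
  (* A point y near z equals (1 - s) w + s x with w in the ball about x0 contained in K, so
     convexity puts it in K. *)
  move=> y [_ zy]; pose w := x0 + (1 - s)^-1 *: (y - z).
  have Kw : K w.
    apply: eK => i; have := zy 0 i; rewrite /ball/= => h.
    rewrite !mxE opprD addrA subrr add0r normrN normrM gtr0_norm ?invr_gt0//.
    by rewrite ltr_pdivrMl// distrC; apply: le_lt_trans h; rewrite le_eqVlt !mxE eqxx.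
  have -> : y = (1 - s) *: w + s *: x.
    rewrite /w scalerDr scalerA mulfV ?gt_eqF// scale1r /z.
    by apply/rowP => i; rewrite !mxE; ring.
  by apply: cvxK => //; rewrite !ltW.
have scal s : 0 < s < 1 -> (mu K <= ((s^-1) ^+ n.+1)%:E * mu K°)%E.
  move=> s01; have /andP[s0 s1] := s01.
  apply: le_trans (outer_homothety _ (x0 - s^-1 *: x0) _); last by rewrite invr_gt0.
  apply: le_outer_measure => x Kx; exists (x0 + s *: (x - x0)); first exact: shrink.
  rewrite scalerDr scalerA mulVf ?gt_eqF// scale1r.
  by apply/rowP => i; rewrite !mxE; ring.
move: Kfin Ifin scal KE.
have : (0 <= mu (K `\` K°))%E by exact: outer_measure_ge0.
have : (0 <= mu K)%E by exact: outer_measure_ge0.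
have : (0 <= mu K°)%E by exact: outer_measure_ge0.
case: (mu K°) => [m|//|//]; case: (mu K) => [M|//|//].
case: (mu (K `\` K°)) => [z|//|//] m0 M0 z0 _ _ scal.
have {}z0 : 0 <= z := z0.
have {}m0 : 0 <= m := m0.
rewrite -EFinD => -[ME]; congr EFin; apply/eqP; rewrite eq_le z0 andbT leNgt.
apply/negP => zp; have mM : m < M by rewrite ME ltrDl.
have bern (t : R) k : 0 <= t -> t <= 1 -> 1 - k%:R * t <= (1 - t) ^+ k.
  move=> t0 t1; elim: k => [|k IH]; first by rewrite mul0r subr0 expr0.
  rewrite exprS; apply: (@le_trans _ _ ((1 - t) * (1 - k%:R * t))); last first.
    by apply: ler_wpM2l => //; rewrite subr_ge0.
  have : 0 <= k%:R * t ^+ 2 by rewrite mulr_ge0 ?sqr_ge0 ?ler0n.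
  by rewrite -[k.+1%:R]natr1; lra.
have Mp : 0 < M by apply: le_lt_trans mM.
(* Chosen so that (n + 1) t = z / (2 M): with s = 1 - t, Bernoulli's inequality gives M - z / 2 <=
   m, against M = m + z. *)
pose t := z / (2 * n.+1%:R * M).
have d0 : 0 < 2 * n.+1%:R * M :> R by rewrite !mulr_gt0 ?ltr0n.
have t0 : 0 < t by rewrite divr_gt0.
have n1 : 1 <= n.+1%:R :> R by rewrite ler1n.
have t1 : t < 1.
  rewrite /t ltr_pdivrMr// mul1r.
  apply: (@le_lt_trans _ _ M); first by rewrite ME lerDr.
  have : M <= n.+1%:R * M by apply: ler_peMl => //; exact: ltW.
  by rewrite -mulrA; lra.
have s01 : 0 < 1 - t < 1 by apply/andP; split; lra.
have := scal _ s01; rewrite -EFinM lee_fin exprVn mulrC ler_pdivlMr; last first.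
  by rewrite exprn_gt0//; lra.
have := bern t n.+1 (ltW t0) (ltW t1).
have nt : n.+1%:R * t = z / (2 * M) by rewrite /t; field; rewrite gt_eqF//= pnatr_eq0.
rewrite nt => b1 b2.
have : M * (1 - z / (2 * M)) <= m.
  by apply: le_trans b2; rewrite ler_wpM2l// ltW.
have -> : M * (1 - z / (2 * M)) = M - z / 2 by field; rewrite gt_eqF.
rewrite ME; lra.
Qed.

End OpenMeasurable.

(** * Differential calculus *)

Section Directional.
Context (R : realType) (n : nat).
Local Notation E := ('rV[R]_n.+1).

Lemma derive_sum_coord (f : E -> R) (x u : E) : differentiable f x ->
  'D_u f x = \sum_i u 0 i * 'D_(delta_mx 0 i) f x.
Proof.
move=> df; rewrite deriveE// {1}(row_sum_delta u) linear_sum/=.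
by apply: eq_bigr => i _; rewrite linearZ/= deriveE.
Qed.

Lemma is_derive_line (f : E -> R) (x u : E) (t : R) : derivable f (x + t *: u) u ->
  is_derive t 1 (fun s : R => f (x + s *: u)) ('D_u f (x + t *: u)).
Proof.
move=> df.
have lineE : (fun h : R => h^-1 *: (((fun s : R => f (x + s *: u)) \o shift t) (h *: 1)
      - (fun s : R => f (x + s *: u)) t)) =
    (fun h : R => h^-1 *: ((f \o shift (x + t *: u)) (h *: u) - f (x + t *: u))).
  apply/funext => h /=; congr (_ *: (f _ - _)).
  by rewrite [h *: 1]mulr1 scalerDl addrCA.
by apply: DeriveDef; rewrite /derivable /derive lineE.
Qed.

(** Derivatives see only the germ of a function. A basis function may thus be replaced by a
    polynomial inside a cell and by 0 off its support. *)
Lemma near_derive (f g : E -> R) (x u : E) : (\forall y \near x, f y = g y) ->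
  'D_u f x = 'D_u g x.
Proof.
move=> fg.
have fgx : f x = g x := nbhs_singleton fg.
have nfg : \forall h \near 0^', f (h *: u + x) = g (h *: u + x).
  apply: cvg_within.
  have : (fun h : R => h *: u + x) h @[h --> 0] --> x.
    rewrite -[X in _ --> X]add0r -(scale0r u).
    by apply: cvgD; [apply: cvgZr_tmp; exact: cvg_id|exact: cvg_cst].
  by move=> /(_ _ fg).
rewrite /derive; congr lim; apply/seteqP; split => A; rewrite /fmap/=.
  by apply: filterS2 nfg => h /= <-; rewrite fgx.
by apply: filterS2 nfg => h /= ->; rewrite fgx.
Qed.

End Directional.

Section Polynomials.
Context (R : realType) (n : nat).
Local Notation E := ('rV[R]_n.+1).
Local Notation peval p := (fun x : E => mpoly.meval (fun i => x 0 i) p).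

(** On a line a polynomial in several variables becomes univariate, which makes the finiteness of
    roots available. *)
Lemma meval_line (p : mpoly.mpoly n.+1 R) (x u : E) :
  exists q : {poly R}, forall t : R, q.[t] = peval p (x + t *: u).
Proof.
exists (\sum_(m <- mpoly.msupp p)
   (mpoly.mcoeff m p)%:P * \prod_i ((x 0 i)%:P + (u 0 i)%:P * 'X) ^+ (mpoly.fun_of_multinom m i)) => t.
rewrite mpoly.mevalE horner_sum; apply: eq_bigr => m _.
rewrite hornerM hornerC horner_prod; congr (_ * _); apply: eq_bigr => i _.
by rewrite horner_exp !hornerE !mxE mulrC.
Qed.

Definition C1 (f : E -> R) :=
  (forall x, differentiable f x) /\ (forall u, continuous ('D_u f)).

Lemma C1_cst (c : R) : C1 (fun=> c).
Proof.
split=> [x|u]; first exact: differentiable_cst.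
have -> : 'D_u (fun=> c : R) = (fun=> 0) :> (E -> R).
  by apply/funext => x; rewrite derive_cst.
exact: cst_continuous.
Qed.

Lemma C1_coord (i : 'I_n.+1) : C1 (fun x => x 0 i).
Proof.
split=> [x|u]; first exact: differentiable_coord.
have -> : 'D_u (fun x : E => x 0 i) = (fun=> u 0 i).
  apply/funext => x.
  have dx : derivable (fun x : E => x 0 i) (x + 0 *: u) u.
    by apply: diff_derivable; exact: differentiable_coord.
  have := @derive_val _ _ _ _ _ _ _ (is_derive_line dx).
  rewrite scale0r addr0 => <-.
  rewrite (_ : (fun s : R => _) = (fun s : R => x 0 i + s * u 0 i)); last first.
    by apply/funext => s; rewrite !mxE.
  by rewrite deriveD// derive_cst add0r deriveMr// derive_id mulr1.
exact: cst_continuous.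
Qed.

Lemma C1_continuous f : C1 f -> continuous f.
Proof. by move=> [df _] x; exact: differentiable_continuous. Qed.

Lemma C1_derivable f : C1 f -> forall x u, derivable f x u.
Proof. by move=> [df _] x u; exact: diff_derivable. Qed.

Lemma C1D f g : C1 f -> C1 g -> C1 (fun x => f x + g x).
Proof.
move=> Cf Cg; split=> [x|u x]; first by apply: differentiableD; [exact: Cf.1|exact: Cg.1].
have -> : 'D_u (fun x => f x + g x) = (fun x => 'D_u f x + 'D_u g x).
  by apply/funext => y; rewrite -[LHS]/('D_u (f + g) y) deriveD//; exact: C1_derivable.
have hf : {for x, continuous ('D_u f)} := Cf.2 u x.
have hg : {for x, continuous ('D_u g)} := Cg.2 u x.
exact: (cvgD hf hg).
Qed.

Lemma C1M f g : C1 f -> C1 g -> C1 (fun x => f x * g x).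
Proof.
move=> Cf Cg; split=> [x|u x]; first by apply: differentiableM; [exact: Cf.1|exact: Cg.1].
have -> : 'D_u (fun x => f x * g x) = (fun x => f x * 'D_u g x + g x * 'D_u f x).
  by apply/funext => y; rewrite -[LHS]/('D_u (f * g) y) deriveM//; exact: C1_derivable.
have hf : {for x, continuous ('D_u f)} := Cf.2 u x.
have hg : {for x, continuous ('D_u g)} := Cg.2 u x.
exact: (cvgD (cvgM (C1_continuous Cf (x := x)) hg) (cvgM (C1_continuous Cg (x := x)) hf)).
Qed.

Lemma C1_sum (I : Type) (r : seq I) (F : I -> E -> R) :
  (forall i, C1 (F i)) -> C1 (fun x => \sum_(i <- r) F i x).
Proof.
move=> CF; elim: r => [|i r IH].
  by rewrite (_ : (fun _ => _) = (fun=> 0)) ?funeqE => [|x]; [exact: C1_cst|rewrite big_nil].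
rewrite (_ : (fun _ => _) = (fun x => F i x + \sum_(i <- r) F i x)); first exact: C1D.
by apply/funext => x; rewrite big_cons.
Qed.

Lemma C1_prod (I : Type) (r : seq I) (F : I -> E -> R) :
  (forall i, C1 (F i)) -> C1 (fun x => \prod_(i <- r) F i x).
Proof.
move=> CF; elim: r => [|i r IH].
  by rewrite (_ : (fun _ => _) = (fun=> 1)) ?funeqE => [|x]; [exact: C1_cst|rewrite big_nil].
rewrite (_ : (fun _ => _) = (fun x => F i x * \prod_(i <- r) F i x)); first exact: C1M.
by apply/funext => x; rewrite big_cons.
Qed.

Lemma C1_meval (p : mpoly.mpoly n.+1 R) : C1 (peval p).
Proof.
rewrite (_ : (fun _ => _) = (fun x : E => \sum_(m <- mpoly.msupp p)
   mpoly.mcoeff m p * \prod_i x 0 i ^+ (mpoly.fun_of_multinom m i))); last first.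
  by apply/funext => x; rewrite mpoly.mevalE.
apply: C1_sum => m; apply: C1M; first exact: C1_cst.
apply: C1_prod => i; elim: (mpoly.fun_of_multinom m i) => [|k IH].
  by under eq_fun do rewrite expr0; exact: C1_cst.
by under eq_fun do rewrite exprS; apply: C1M; [exact: C1_coord|].
Qed.

End Polynomials.

Section EuclideanNorm.
Context (R : realType) (n : nat).
Local Notation E := ('rV[R]_n.+1).
Implicit Types (x y u v : E).

Lemma enorm_ge0 x : 0 <= enorm x. Proof. exact: sqrtr_ge0. Qed.

Lemma sqr_enorm x : enorm x ^+ 2 = \sum_i x 0 i ^+ 2.
Proof. by rewrite sqr_sqrtr// sumr_ge0// => i _; exact: sqr_ge0. Qed.

Lemma enormZ (a : R) x : enorm (a *: x) = `|a| * enorm x.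
Proof.
rewrite /enorm; under eq_bigr do rewrite mxE exprMn.
by rewrite -mulr_sumr sqrtrM ?sqr_ge0// sqrtr_sqr.
Qed.

Lemma enorm_gt0 x : x != 0 -> 0 < enorm x.
Proof.
move=> x0; rewrite sqrtr_gt0 lt_neqAle sumr_ge0 ?andbT; last by move=> i _; exact: sqr_ge0.
apply: contra_neq x0 => /esym/eqP; rewrite psumr_eq0 => [/allP s0|i _]; last exact: sqr_ge0.
apply/rowP => i; rewrite mxE; have := s0 i; rewrite mem_index_enum sqrf_eq0 => /(_ isT).
by move/eqP.
Qed.

Lemma cauchy_schwarz x y : `|\sum_i x 0 i * y 0 i| <= enorm x * enorm y.
Proof.
set c := \sum_i _; have [y_0|y0] := eqVneq y 0.
  rewrite (_ : c = 0) ?normr0 ?mulr_ge0 ?enorm_ge0//.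
  by apply: big1 => i _; rewrite y_0 mxE mulr0.
have b0 : 0 < enorm y ^+ 2 by rewrite exprn_gt0// enorm_gt0.
rewrite -(ler_pXn2r (_ : (0 < 2)%N)) ?nnegrE ?mulr_ge0 ?enorm_ge0//.
rewrite exprMn real_normK ?num_real//.
(* Up to the factor |y|^2, this is the component of x orthogonal to y. *)
have : 0 <= \sum_i (enorm y ^+ 2 * x 0 i - c * y 0 i) ^+ 2.
  by apply: sumr_ge0 => i _; exact: sqr_ge0.
have -> : \sum_i (enorm y ^+ 2 * x 0 i - c * y 0 i) ^+ 2 =
    enorm y ^+ 2 * (enorm x ^+ 2 * enorm y ^+ 2 - c ^+ 2).
  transitivity (\sum_i (enorm y ^+ 4 * x 0 i ^+ 2 - 2 * enorm y ^+ 2 * c * (x 0 i * y 0 i)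
     + c ^+ 2 * y 0 i ^+ 2)); first by apply: eq_bigr => i _; ring.
  rewrite big_split sumrB/= -!mulr_sumr -!sqr_enorm -/c; ring.
by rewrite pmulr_rge0// subr_ge0.
Qed.

Lemma coord_le_enorm x i : `|x 0 i| <= enorm x.
Proof.
rewrite -(ler_pXn2r (_ : (0 < 2)%N)) ?nnegrE ?enorm_ge0//.
rewrite sqr_enorm real_normK ?num_real// (bigD1 i)//= lerDl.
by apply: sumr_ge0 => j _; exact: sqr_ge0.
Qed.

Lemma enorm_continuous : continuous (@enorm R n).
Proof.
move=> x; apply: (@continuous_comp _ _ _ (fun x : E => \sum_i x 0 i ^+ 2) Num.sqrt).
  apply: continuous_sumr => i _.
  have ci : {for x, continuous (fun w : E => w 0 i)} by exact: coord_continuous.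
  exact: (cvgM ci ci).
exact: sqrt_continuous.
Qed.

Lemma compact_max (T : set E) (f : E -> R) : compact T -> T !=set0 ->
  (forall x, T x -> {for x, continuous f}) -> exists m, is_max_on T f m.
Proof.
move=> cT T0 cf; have wcf : {within T, continuous f}.
  by apply: continuous_in_subspaceT => x; rewrite inE => /cf.
have [c cT' cmax] := EVT_max_rV T0 cT wcf.
exists (f c); split; first by exists c => //; rewrite inE in cT'.
by move=> x Tx; apply: cmax; rewrite inE.
Qed.

End EuclideanNorm.

Lemma ler_dist2 (R : realDomainType) (a b c : R) :
  a <= b + c -> b <= a + c -> `|a - b| <= c.
Proof. by move=> h1 h2; rewrite ler_norml; apply/andP; split; lra. Qed.

Section SecondOrder.
Context (R : realType) (n : nat).
Local Notation E := ('rV[R]_n.+1).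
Variables (U : set E) (f : E -> R).
Hypotheses (oU : open U) (fC2 : C2_on U f).
Implicit Types (x y u v : E).

Local Notation H i j x := ('D_(delta_mx 0 j) ('D_(delta_mx 0 i) f) x).

(** The expansion of 'D_u f holds on the open set U, so it may be differentiated once more.
    Everything about D^2 f is thereby reduced to finitely many continuous entries. *)
Lemma D2_sum u v x : U x ->
  'D_v ('D_u f) x = \sum_i \sum_j u 0 i * v 0 j * H i j x.
Proof.
case: fC2 => df d2f _ Ux.
rewrite derive_sum_coord; last exact: d2f.
rewrite exchange_big/=; apply: eq_bigr => j _.
have -> : 'D_(delta_mx 0 j) ('D_u f) x =
    'D_(delta_mx 0 j) (\sum_i (u 0 i *: 'D_(delta_mx 0 i) f)) x.
  apply: near_derive; near=> y; rewrite derive_sum_coord; last first.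
    by apply: df; near: y; exact: open_nbhs_nbhs.
  by rewrite fct_sumE.
rewrite derive_sum => [|i]; last first.
  by apply: derivableZ; apply: diff_derivable; exact: d2f.
rewrite mulr_sumr; apply: eq_bigr => i _.
rewrite deriveZ; last by apply: diff_derivable; exact: d2f.
by rewrite mulrCA mulrA.
Unshelve. all: by end_near. Qed.

Let S2 x := [set r | exists u v, [/\ enorm u = 1, enorm v = 1 & r = `|'D_v ('D_u f) x|]].

Lemma D2_dist u v x y : U x -> U y -> enorm u = 1 -> enorm v = 1 ->
  `|'D_v ('D_u f) x| <= `|'D_v ('D_u f) y| + \sum_i \sum_j `|H i j x - H i j y|.
Proof.
move=> Ux Uy u1 v1; rewrite -lerBlDl; apply: le_trans (lerB_dist _ _) _.
rewrite !D2_sum// -sumrB; apply: le_trans (ler_norm_sum _ _ _) _.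
apply: ler_sum => i _; rewrite -sumrB; apply: le_trans (ler_norm_sum _ _ _) _.
apply: ler_sum => j _; rewrite -mulrBr normrM ler_piMl// normrM.
by apply: mulr_ile1 => //; [rewrite -u1|rewrite -v1]; exact: coord_le_enorm.
Qed.

Lemma S2_has_sup x : U x -> has_sup (S2 x).
Proof.
move=> Ux; have e1 : enorm (delta_mx 0 0 : E) = 1.
  rewrite /enorm (bigD1 0)//= big1 => [|i i0]; last by rewrite mxE (negbTE i0) andbF expr0n.
  by rewrite mxE !eqxx expr1n addr0 sqrtr1.
split; first by exists `|'D_(delta_mx 0 0) ('D_(delta_mx 0 0) f) x|; exists (delta_mx 0 0), (delta_mx 0 0).
exists (\sum_i \sum_j `|H i j x|) => _ [u [v [u1 v1 ->]]].
rewrite D2_sum//; apply: le_trans (ler_norm_sum _ _ _) _.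
apply: ler_sum => i _; apply: le_trans (ler_norm_sum _ _ _) _.
apply: ler_sum => j _; rewrite normrM ler_piMl// normrM.
by apply: mulr_ile1 => //; [rewrite -u1|rewrite -v1]; exact: coord_le_enorm.
Qed.

Lemma le_norm_D2 u v x : U x -> enorm u = 1 -> enorm v = 1 ->
  `|'D_v ('D_u f) x| <= norm_D2 f x.
Proof.
move=> Ux u1 v1; apply: sup_upper_bound; first exact: S2_has_sup.
by exists u, v.
Qed.

Lemma D2_le u x : U x -> `|'D_u ('D_u f) x| <= enorm u ^+ 2 * norm_D2 f x.
Proof.
move=> Ux; have [->|u0] := eqVneq u 0.
  rewrite D2_sum// big1 ?normr0; last by move=> i _; rewrite big1// => j _; rewrite !mxE !mul0r.
  by rewrite (_ : enorm 0 = 0) ?expr0n ?mul0r// -(scale0r (0 : E)) enormZ normr0 mul0r.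
have nu := enorm_gt0 u0; pose w := (enorm u)^-1 *: u.
have w1 : enorm w = 1 by rewrite enormZ gtr0_norm ?invr_gt0// mulVf ?gt_eqF.
have -> : 'D_u ('D_u f) x = enorm u ^+ 2 * 'D_w ('D_w f) x.
  rewrite !D2_sum// mulr_sumr; apply: eq_bigr => i _; rewrite mulr_sumr.
  by apply: eq_bigr => j _; rewrite !mxE; field; rewrite gt_eqF.
rewrite normrM ger0_norm ?sqr_ge0//; apply: ler_wpM2l; first exact: sqr_ge0.
exact: le_norm_D2.
Qed.

Lemma norm_D2_ge0 x : U x -> 0 <= norm_D2 f x.
Proof.
move=> Ux; pose e : E := delta_mx 0 0.
have e0 : e != 0.
  by apply/eqP => /matrixP/(_ 0 0); rewrite !mxE !eqxx => /eqP; rewrite oner_eq0.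
have := le_trans (normr_ge0 _) (D2_le e Ux).
by rewrite pmulr_rge0// exprn_gt0// enorm_gt0.
Qed.

Lemma norm_D2_dist x y : U x -> U y ->
  norm_D2 f x <= norm_D2 f y + \sum_i \sum_j `|H i j x - H i j y|.
Proof.
move=> Ux Uy; apply: ge_sup; first exact: (S2_has_sup Ux).1.
move=> _ [u [v [u1 v1 ->]]]; apply: le_trans (D2_dist Ux Uy u1 v1) _.
by rewrite lerD2r; exact: le_norm_D2.
Qed.

(** A supremum of continuous functions need not be continuous. Here the entries of the Hessian bound
    the variation uniformly in the unit vectors u and v. *)
Lemma norm_D2_continuous x : U x -> {for x, continuous (norm_D2 f)}.
Proof.
move=> Ux; pose s y := \sum_i \sum_j `|H i j x - H i j y|.
have cs : s y @[y --> x] --> 0.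
  have -> : (0 : R) = s x by rewrite /s big1// => i _; rewrite big1// => j _; rewrite subrr normr0.
  apply: continuous_sumr => i _; apply: continuous_sumr => j _.
  have cH : {for x, continuous ('D_(delta_mx 0 j) ('D_(delta_mx 0 i) f))}.
    by case: fC2 => _ _; exact.
  have cN : {for x, continuous (fun y => H i j x - H i j y)}.
    by apply: (@continuousB _ _ _ (fun=> H i j x)); [exact: cst_continuous|exact: cH].
  exact: (cvg_norm cN).
suff : norm_D2 f y @[y --> x] --> norm_D2 f x by [].
have syE y : \sum_i \sum_j `|H i j y - H i j x| = s y.
  apply: eq_bigr => i _; apply: eq_bigr => j _; exact: distrC.
have key y : U y -> `|norm_D2 f x - norm_D2 f y| <= s y.
  move=> Uy; have h1 := norm_D2_dist Ux Uy; have h2 := norm_D2_dist Uy Ux.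
  by rewrite syE in h2; exact: ler_dist2 h1 h2.
have FF : Filter (nbhs x) := nbhs_filter x.
have nU : \forall y \near x, U y by exact: open_nbhs_nbhs.
apply/(@cvgrPdist_le _ _ _ (nbhs x) FF) => e e0.
have := cs; move/(@cvgrPdist_le _ _ _ (nbhs x) FF) => /(_ e e0).
apply: filterS2 nU => y Uy sy; apply: le_trans (key y Uy) _.
by apply: le_trans sy; rewrite sub0r normrN ler_norm.
Qed.

Lemma taylor_segment x u (M : R) : (forall t : R, 0 <= t <= 1 -> U (x + t *: u)) ->
    (forall t : R, 0 <= t <= 1 -> `|'D_u ('D_u f) (x + t *: u)| <= M) ->
  `|f (x + u) - f x| <= `|'D_u f x| + 2^-1 * M.
Proof.
case: fC2 => df d2f _ seg D2M.
pose g (t : R) : R := f (x + t *: u); pose g1 (t : R) : R := 'D_u f (x + t *: u).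
pose g2 (t : R) : R := 'D_u ('D_u f) (x + t *: u).
have dg (t : R) : 0 <= t <= 1 -> is_derive t 1 g (g1 t).
  by move=> t01; apply: is_derive_line; apply: diff_derivable; exact/df/seg.
have dg1 (t : R) : 0 <= t <= 1 -> is_derive t 1 g1 (g2 t).
  by move=> t01; apply: is_derive_line; apply: diff_derivable; exact/d2f/seg.
have M0 : 0 <= M by apply: le_trans (D2M 0 _); rewrite ?lexx ?ler01.
have g1M (t : R) : 0 < t < 1 -> `|g1 t - g1 0| <= M * t.
  move=> /andP[t0 t1].
  have [||c c0t] := @MVT R g1 g2 0 t t0.
  - by move=> y; rewrite in_itv/= => /andP[y0 yt]; apply: dg1; rewrite !ltW// (lt_trans yt).
  - apply: derivable_within_continuous => y; rewrite in_itv/= => /andP[y0 yt].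
    by have [] : is_derive y 1 g1 (g2 y) by apply: dg1; rewrite y0 (le_trans yt)// ltW.
  rewrite subr0 => ->; rewrite normrM (gtr0_norm t0) ler_pM2r//.
  by apply: D2M; move: c0t; rewrite in_itv/= => /andP[/ltW -> ct]; rewrite ltW// (lt_trans ct).
(* The sign s gives both bounds at once. The derivative of [psi] at t in (0, 1) is at most |g1 t -
   g1 0| - M t <= 0, so psi 1 <= psi 0. *)
have key (s : R) : `|s| = 1 -> s * (g 1 - g 0 - g1 0) <= 2^-1 * M.
  move=> s1; pose psi (t : R) : R := s * g t - s * g1 0 * t - 2^-1 * M * t ^+ 2.
  pose dpsi (t : R) : R := s * g1 t - s * g1 0 - M * t.
  have dp (t : R) : 0 <= t <= 1 -> is_derive t 1 psi (dpsi t).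
    move=> t01; have := dg t t01 => ?; rewrite /psi /dpsi; apply: is_derive_eq.
    by rewrite /GRing.scale/=; field.
  have [||c] := @MVT R psi dpsi 0 1 ltr01.
  - by move=> y; rewrite in_itv/= => /andP[y0 y1]; apply: dp; rewrite !ltW.
  - apply: derivable_within_continuous => y; rewrite in_itv/= => y01.
    by have [] := dp y y01.
  rewrite in_itv/= => c01; rewrite subr0 mulr1 /psi /dpsi.
  have := g1M c c01; have : s * (g1 c - g1 0) <= `|g1 c - g1 0|.
    by apply: le_trans (ler_norm _) _; rewrite normrM s1 mul1r.
  lra.
have h1 := key 1 (normr1 _); have h2 := key (-1) (normrN1 _).
have e1 : g 1 = f (x + u) by rewrite /g scale1r.
have e0 : g 0 = f x by rewrite /g scale0r addr0.
have e2 : g1 0 = 'D_u f x by rewrite /g1 scale0r addr0.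
rewrite e1 e0 e2 in h1 h2.
have := ler_norm ('D_u f x); have := ler_norm (- 'D_u f x); rewrite normrN => n1 n2.
by rewrite ler_norml; apply/andP; split; lra.
Qed.

Lemma taylor_star_shaped (T : set E) x y (D2 : R) : T `<=` U -> T x -> T y ->
    star_shaped_about x T -> (forall z, T z -> norm_D2 f z <= D2) ->
  `|f y - f x| <= enorm (y - x) * enorm (grad f x) + 2^-1 * enorm (y - x) ^+ 2 * D2.
Proof.
move=> TU Tx Ty star D2max.
have seg (t : R) : 0 <= t <= 1 -> T (x + t *: (y - x)) by exact: star.
have {1}-> : y = x + (y - x) by rewrite addrC subrK.
apply: le_trans (taylor_segment (M := enorm (y - x) ^+ 2 * D2) _ _) _.
- by move=> t /seg/TU.
- move=> t /seg Tt; apply: le_trans (D2_le _ (TU _ Tt)) _.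
  by apply: ler_wpM2l; [exact: sqr_ge0 | exact: D2max].
rewrite mulrA lerD2r derive_sum_coord; last by case: fC2 => df _ _; exact/df/TU.
have -> : \sum_i (y - x) 0 i * 'D_(delta_mx 0 i) f x = \sum_i (y - x) 0 i * grad f x 0 i.
  by apply: eq_bigr => i _; rewrite [grad _ _ _ _]mxE.
exact: cauchy_schwarz.
Qed.

End SecondOrder.

(** * Meshes and supports of basis functions *)

Section Hull.
Context (R : realType) (n m : nat).
Local Notation E := ('rV[R]_n.+1).
Variables (p : 'I_m -> E) (S : {set 'I_m}).

Lemma hull_convex x y (t : R) : hull p S x -> hull p S y -> 0 <= t <= 1 ->
  hull p S ((1 - t) *: x + t *: y).
Proof.
move=> [w [w0 w1 ->]] [z [z0 z1 ->]] /andP[t0 t1].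
exists (fun i => (1 - t) * w i + t * z i); split.
- by move=> i; rewrite addr_ge0// mulr_ge0// subr_ge0.
- by rewrite big_split/= -!mulr_sumr w1 z1; ring.
- rewrite !scaler_sumr -big_split/=; apply: eq_bigr => i _.
  by rewrite !scalerA -scalerDl.
Qed.

Lemma hull_segment x y (t : R) : hull p S x -> hull p S y -> 0 <= t <= 1 ->
  hull p S (x + t *: (y - x)).
Proof.
move=> hx hy t01; suff -> : x + t *: (y - x) = (1 - t) *: x + t *: y by exact: hull_convex.
by rewrite scalerBr scalerBl scale1r addrA addrAC.
Qed.

(** The hull is the continuous image of a compact set of weights. *)
Lemma hull_closed : closed (hull p S).
Proof.
pose W := [set w : 'rV[R]_m | (forall i, 0 <= w 0 i <= 1) /\ \sum_(i in S) w 0 i = 1].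
pose g (w : 'rV[R]_m) : E := \sum_(i in S) w 0 i *: p i.
have -> : hull p S = g @` W.
  apply/seteqP; split => [x [w [w0 w1 ->]]|_ [w [w01 w1] <-]]; last first.
    by exists (w 0); split => // i; have /andP[] := w01 i.
  have wS i : i \in S -> w i <= 1.
    by move=> iS; rewrite -w1 (bigD1 i)//= lerDl sumr_ge0.
  (* [hull] leaves the weights outside S unbounded; setting them to 0 changes neither sum. *)
  exists (\row_i if i \in S then w i else 0); last first.
    by apply: eq_bigr => i iS; rewrite mxE iS.
  split; last by rewrite -w1; apply: eq_bigr => i iS; rewrite mxE iS.
  by move=> i; rewrite mxE; case: ifP => iS; rewrite ?w0 ?wS ?lexx ?ler01.
have gc : continuous g.
  move=> w; apply: (cvg_big add_continuous (nbhs_filter w)) => i _.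
  have ci : {for w, continuous (fun w : 'rV[R]_m => w 0 i)} by exact: coord_continuous.
  exact: (cvgZ ci (cvg_cst (p i))).
apply: compact_closed; first exact: norm_hausdorff.
apply: continuous_compact; first exact: continuous_subspaceT.
apply: bounded_closed_compact.
  exists 1; split => // a a1 w [w01 _] /=; rewrite [leLHS]/Num.Def.normr/= mx_normrE.
  apply/bigmax_leP; split=> [|[i j] _ /=]; first by rewrite ltW// (lt_trans ltr01).
  have /andP[h0 h1] := w01 j.
  by rewrite ord1 ger0_norm// (le_trans h1)// ltW.
rewrite (_ : W = (\bigcap_(i in [set: 'I_m]) [set w : 'rV[R]_m | 0 <= w 0 i <= 1]) `&`
    [set w : 'rV[R]_m | \sum_(i in S) w 0 i = 1]); last first.
  apply/seteqP; split => [w [h1 h2]|w [h1 h2]]; split => // i; [move=> _; exact: h1|exact: h1].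
apply: closedI.
  apply: closed_bigI => i _.
  rewrite (_ : [set w : 'rV[R]_m | 0 <= w 0 i <= 1] = (fun w : 'rV[R]_m => w 0 i) @^-1` `[0, 1]).
    by apply: preimage_closed; [move=> w _; exact: coord_continuous|exact: itv_closed].
  by apply/seteqP; split => w /=; rewrite in_itv.
apply: (@preimage_closed _ _ (fun w : 'rV[R]_m => \sum_(i in S) w 0 i) [set 1]).
  by move=> w _; apply: continuous_sumr => i _; exact: coord_continuous.
exact: closed_eq.
Qed.

End Hull.

Lemma bounded_closure (R : realType) n (A : set 'rV[R]_n.+1) :
  bounded_set A -> bounded_set (closure A).
Proof.
move=> [C [Cr bC]]; exists C; split => // a Ca.
have clB : closed ((fun x : 'rV[R]_n.+1 => `|x|) @^-1` [set r | r <= a]).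
  by apply: preimage_closed; [move=> x _; exact: norm_continuous|exact: closed_le].
move=> x clx; have := closure_subset (bC a Ca) clx.
by rewrite -[X in closure X]/((fun x : 'rV[R]_n.+1 => `|x|) @^-1` [set r | r <= a]) -(iffLR (closure_id _) clB).
Qed.

(** A nonzero polynomial has fewer than [size q] roots, so it cannot vanish at [size q] distinct
    points inside the interval. *)
Lemma poly_nonroot (R : realFieldType) (q : {poly R}) (a b : R) : q != 0 -> a < b ->
  exists2 t, a < t < b & q.[t] != 0.
Proof.
move=> q0 ab; have ba0 : 0 < b - a by rewrite subr_gt0.
pose s i : R := a + (b - a) * (i.+1%:R / (size q).+1%:R).
have [rs|/allPn[_ /mapP[i iq ->] qs]] := boolP (all (root q) [seq s i | i <- iota 0 (size q)]).
  have := max_poly_roots q0 rs.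
  rewrite size_map size_iota ltnn => H; suff /H : uniq [seq s i | i <- iota 0 (size q)] by [].
  rewrite map_inj_uniq ?iota_uniq// => i k.
  move=> /(congr1 (fun r => (r - a) / (b - a) * (size q).+1%:R)).
  have sE i' : (s i' - a) / (b - a) * (size q).+1%:R = i'.+1%:R.
    by rewrite /s; field; rewrite gt_eqF//= addrC natr1 pnatr_eq0.
  by rewrite !sE => /eqP; rewrite eqr_nat eqSS => /eqP.
exists (s i) => //; rewrite /s ltrDl mulr_gt0 ?divr_gt0 ?ltr0n//= -ltrBrDl.
rewrite -[ltRHS]mulr1 ltr_pM2l// ltr_pdivrMr ?ltr0n// mul1r ltr_nat ltnS.
by move: iq; rewrite mem_iota.
Qed.

Section Support.
Context (R : realType) (n : nat) (Omega : set 'rV[R]_n.+1) (M : mesh Omega) (N : nat).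
Context (dof : 'I_N -> 'I_(nnode M)) (phi : 'I_N -> 'rV[R]_n.+1 -> R).
Hypothesis phi_basis : nodal_basis dof phi.
Local Notation E := ('rV[R]_n.+1).

Lemma cell_closed c : closed (cell M c).
Proof. exact: hull_closed. Qed.

Lemma cell_closure c : cell M c `<=` closure Omega.
Proof. by move=> x cx; rewrite -(cell_cover M); exists c. Qed.

Lemma supp_closure j : supp (phi j) `<=` closure Omega.
Proof.
apply: closure_subset => x /= px; apply: contrapT => Ox.
by move: px; rewrite (basis_zero phi_basis) ?eqxx.
Qed.

Lemma basis_at_node j : phi j (node M (dof j)) = 1.
Proof. by rewrite (basis_nodal phi_basis) eqxx. Qed.

Lemma supp_cell j x : supp (phi j) x -> exists2 c, cell M c (node M (dof j)) & cell M c x.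
Proof.
pose Z := \bigcup_(c in [set c | cell M c (node M (dof j))]) cell M c.
have clZ : closed Z by apply: closed_bigcup => [|c _]; [exact: finite_finset|exact: cell_closed].
suff : supp (phi j) `<=` Z by move=> h /h [c cj cx]; exists c.
rewrite (iffLR (closure_id Z) clZ); apply: closure_subset => y /= py.
have [c _ cy] : (\bigcup_c cell M c) y.
  rewrite (cell_cover M); apply: subset_closure; apply: contrapT => Oy.
  by move: py; rewrite (basis_zero phi_basis) ?eqxx.
exists c => //=; apply: contrapT => cj; move: py.
by rewrite (basis_local phi_basis cj) ?eqxx.
Qed.

(* A nonzero polynomial on the segment from the node of phi_j has finitely many
   zeros. *)
Lemma cell_supp j c : cell M c (node M (dof j)) -> cell M c `<=` supp (phi j).
Proof.
set x := node M (dof j) => cx y cy A /nbhs_ballP[e /= e0 yA].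
have [p pE] := basis_polynomial phi_basis j c.
have [q qE] := meval_line p x (y - x).
have phiq (t : R) : 0 <= t <= 1 -> phi j (x + t *: (y - x)) = q.[t].
  by move=> t01; rewrite qE pE//; exact: hull_segment.
have q0 : q != 0.
  apply/eqP => q0; have := phiq 0; rewrite scale0r addr0 basis_at_node q0 horner0.
  by rewrite lexx ler01 => /(_ isT)/eqP; rewrite oner_eq0.
(* For t in (1 - d, 1) the point of the segment is within e of y; the added 1 covers the case y =
   x. *)
pose d := Num.min 1 (e / (`|y - x| + 1)).
have n1 : 0 < `|y - x| + 1 by rewrite ltr_wpDl.
have d0 : 0 < d by rewrite lt_min ltr01 divr_gt0.
have [t [t01 td qt]] : exists t, [/\ 0 <= t <= 1, (1 - t) * `|y - x| < e & q.[t] != 0].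
  have d1 : d <= 1 by rewrite ge_min lexx.
  have [|t /andP[td t1] qt] := @poly_nonroot _ q (1 - d) 1 q0; first by rewrite gtrBl.
  exists t; split => //; first by rewrite (ltW t1) andbT (le_trans _ (ltW td))// subr_ge0.
  apply: (@le_lt_trans _ _ (e / (`|y - x| + 1) * `|y - x|)).
    apply: ler_wpM2r => //; rewrite lerBlDr -lerBlDl.
    by apply: le_trans (ltW td); rewrite lerD2l lerN2 ge_min lexx orbT.
  by rewrite mulrAC ltr_pdivrMr// ltr_pM2l// ltrDl.
exists (x + t *: (y - x)); split; first by rewrite /= phiq.
apply: yA; rewrite mx_norm_ball /ball_/=.
have -> : y - (x + t *: (y - x)) = (1 - t) *: (y - x).
  by apply/rowP => i; rewrite !mxE; ring.
by rewrite normrZ ger0_norm// subr_ge0; case/andP: t01.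
Qed.

Lemma star_shaped_node j : star_shaped_about (node M (dof j)) (supp (phi j)).
Proof.
move=> y t /supp_cell[c cx cy] t01; apply: (cell_supp cx); exact: hull_segment.
Qed.

End Support.

Section OneDimensional.
Context (R : realType).

(** On a line, a set star-shaped about one point is an interval, and an interval is star-shaped
    about each of its points. *)
Lemma star_shaped1 n (a b : 'rV[R]_n.+1) (T : set 'rV[R]_n.+1) : n = 0%N ->
  star_shaped_about a T -> T b -> star_shaped_about b T.
Proof.
move=> n0; subst n => Ta Tb y t Ty /andP[t0 t1].
have Taa : T a by rewrite -[a]addr0 -(scale0r (y - a)); apply: Ta => //; rewrite lexx ler01.
set z := b + t *: (y - b).
(* The four cases at the end show that z lies between a and b or between a and y. *)
have key (c : 'rV[R]_1) : T c -> (a 0 0 <= z 0 0 <= c 0 0) || (c 0 0 <= z 0 0 <= a 0 0) -> T z.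
  move=> Tc zac.
  have [ca|ca] := eqVneq (c 0 0 - a 0 0) 0.
    suff -> : z = a by [].
    apply/rowP => i; rewrite ord1; move: ca zac => /subr0_eq -> /orP[]/andP[h1 h2];
    by apply/eqP; rewrite eq_le h1 h2.
  have -> : z = a + ((z 0 0 - a 0 0) / (c 0 0 - a 0 0)) *: (c - a).
    by apply/rowP => i; rewrite ord1 !mxE; field.
  apply: Ta => //; case/orP: zac => /andP[h1 h2].
    have ca0 : 0 < c 0 0 - a 0 0 by rewrite lt_neqAle eq_sym ca subr_ge0 (le_trans h1).
    by rewrite divr_ge0 ?subr_ge0// ?(le_trans h1)//= ler_pdivrMr// mul1r lerD2r.
  have ca0 : c 0 0 - a 0 0 < 0 by rewrite lt_neqAle ca subr_le0 (le_trans h1).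
  rewrite -mulrNN -invrN !opprB divr_ge0 ?subr_ge0// ?(le_trans h1)//=.
  by rewrite ler_pdivrMr ?mul1r ?lerD2l ?lerN2// -oppr_lt0 opprB.
have zE : z 0 0 = b 0 0 + t * (y 0 0 - b 0 0) by rewrite !mxE.
have [yb|/ltW yb] := leP (b 0 0) (y 0 0); have [za|/ltW za] := leP (z 0 0) (a 0 0).
- by apply: (key b Tb); rewrite za zE lerDl mulr_ge0 ?subr_ge0// orbT.
- apply: (key y Ty); rewrite za /=; apply/orP; left.
  by rewrite zE -lerBrDl ler_piMl// subr_ge0.
- apply: (key y Ty); rewrite za /= andbT; apply/orP; right.
  rewrite zE; have : (1 - t) * (y 0 0 - b 0 0) <= 0 by rewrite mulr_ge0_le0 ?subr_ge0 ?subr_le0.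
  by lra.
- apply: (key b Tb); rewrite za /=; apply/orP; left.
  by rewrite zE gerDl mulr_ge0_le0// subr_le0.
Qed.

End OneDimensional.

(** * Stiffness matrices *)

Section Galerkin.
Context (R : realType) (n : nat) (Omega : set 'rV[R]_n.+1) (M : mesh Omega) (N : nat).
Context (dof : 'I_N -> 'I_(nnode M)) (phi : 'I_N -> 'rV[R]_n.+1 -> R).
Hypotheses (oO : open Omega) (bO : bounded_set Omega) (phi_basis : nodal_basis dof phi).
Local Notation E := ('rV[R]_n.+1).
Local Notation EC := (caratheodory_type (@lebesgue_outer R n)).
Local Notation mu := (@lebesgue_rV R n).
Local Notation peval p := (fun x : E => mpoly.meval (fun i => x 0 i) p).

Let cell_poly (c : 'I_(ncell M)) (i : 'I_N) : mpoly.mpoly n.+1 R :=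
  sval (cid (basis_polynomial phi_basis i c)).

Let cell_polyE c i x : cell M c x -> phi i x = peval (cell_poly c i) x.
Proof. by move=> cx; rewrite (svalP (cid (basis_polynomial phi_basis i c))). Qed.

Let mO : measurable (Omega : set EC). Proof. exact: open_caratheodory. Qed.

Let muO : (mu Omega < +oo)%E. Proof. exact: outer_bounded_lty. Qed.

Let cells : set E := \bigcup_(c in [set: 'I_(ncell M)]) (cell M c)°.

Let skel : set E := Omega `\` cells.

Let open_cells : open cells.
Proof. by apply: bigcup_open => c _; exact: open_interior. Qed.

Let mskel : measurable (skel : set EC).
Proof. by apply: measurableD => //; apply: open_caratheodory; exact: open_cells. Qed.

Lemma cell_boundary_null c : lebesgue_outer (cell M c `\` (cell M c)°) = 0%E.
Proof.
apply: convex_boundary_null.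
- exact: cell_closed.
- have [C [Cr bC]] := bounded_closure bO; exists C; split => // a Ca x /cell_closure.
  exact: bC.
- by move=> x y t; exact: hull_convex.
- exact: cell_interior_neq0.
Qed.

Let mu_skel : mu skel = 0%E.
Proof.
apply/eqP; rewrite eq_le outer_measure_ge0 andbT.
apply: (@le_trans _ _ (lebesgue_outer
    (\big[setU/set0]_(c < ncell M) (cell M c `\` (cell M c)°)))).
  apply: le_outer_measure => x [Ox ncx].
  have [c _ cx] : (\bigcup_c cell M c) x by rewrite (cell_cover M); exact: subset_closure.
  rewrite -bigcup_seq; exists c; first by rewrite /= mem_index_enum.
  by split => // icx; apply: ncx; exists c.
elim/big_rec : _ => [|c A _ IH]; first by rewrite outer_measure0.
apply: le_trans (outer_measureU2 _ _ _) _.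
by rewrite [X in (X + _ <= _)%E](_ : _ = 0%E) ?add0e//; exact: cell_boundary_null.
Qed.

Lemma grad_cell c i l x : (cell M c)° x ->
  grad (phi i) x 0 l = 'D_(delta_mx 0 l) (peval (cell_poly c i)) x.
Proof.
move=> cx; rewrite mxE; apply: near_derive.
have := open_nbhs_nbhs (conj (@open_interior _ (cell M c)) cx).
by apply: filterS => y /interior_subset; exact: cell_polyE.
Qed.

(** Inside each cell the gradient is continuous; on the remaining null set every subset is
    measurable, by completeness of the measure. *)
Lemma measurable_grad i l : measurable_fun (Omega : set EC) (fun x : EC => grad (phi i) x 0 l).
Proof.
move=> _ Y mY.
have -> : Omega `&` (fun x => grad (phi i) x 0 l) @^-1` Y =
    (\bigcup_(c in [set: 'I_(ncell M)]) (Omega `&` (cell M c)° `&`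
      ('D_(delta_mx 0 l) (peval (cell_poly c i))) @^-1` Y)) `|`
    (skel `&` (fun x => grad (phi i) x 0 l) @^-1` Y).
  apply/seteqP; split => [x [Ox xY]|x [[c _ [[Ox cx] xY]]|[[Ox _] xY]//]]; last first.
    by split => //=; rewrite (grad_cell _ _ cx).
  have [[c _ cx]|ncx] := pselect (cells x); last by right; split.
  by left; exists c => //; split => //=; rewrite -(grad_cell _ _ cx).
have mG c : measurable_fun (setT : set EC)
    ('D_(delta_mx 0 l) (peval (cell_poly c i)) : EC -> R).
  by apply: continuous_measurable; exact: (C1_meval (cell_poly c i)).2.
apply: measurableU.
  apply: fin_bigcup_measurable => [|c _]; first exact: finite_finset.
  apply: measurableI; last by rewrite -[_ @^-1` _]setTI; exact: mG.
  by apply: measurableI => //; apply: open_caratheodory; exact: open_interior.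
apply: outer0_caratheodory; apply/eqP.
rewrite eq_le outer_measure_ge0 andbT -mu_skel; apply: le_outer_measure.
exact: subIsetl.
Qed.

(* The bound is not required on the boundaries of the cells, where the
   gradients of the basis functions need not exist. *)
Definition tame (f : E -> R) := measurable_fun (Omega : set EC) (f : EC -> R) /\
  exists C, forall x, Omega x -> cells x -> `|f x| <= C.

Lemma tame_cst (a : R) : tame (fun=> a).
Proof. by split; [exact: measurable_cst|exists `|a|]. Qed.

Lemma tameD f g : tame f -> tame g -> tame (fun x => f x + g x).
Proof.
move=> [mf [C fC]] [mg [D gD]]; split; first exact: measurable_funD.
exists (C + D) => x Ox cx; apply: le_trans (ler_normD _ _) _.
by apply: lerD; [exact: fC|exact: gD].
Qed.

Lemma tameM f g : tame f -> tame g -> tame (fun x => f x * g x).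
Proof.
move=> [mf [C fC]] [mg [D gD]]; split; first exact: measurable_funM.
exists (C * D) => x Ox cx; rewrite normrM.
by apply: ler_pM => //; [exact: fC|exact: gD].
Qed.

Lemma tame_sum (I : Type) (r : seq I) (F : I -> E -> R) : (forall i, tame (F i)) ->
  tame (fun x => \sum_(i <- r) F i x).
Proof.
move=> tF; elim: r => [|i r IH].
  by under eq_fun do rewrite big_nil; exact: tame_cst.
by under eq_fun do rewrite big_cons; exact: tameD.
Qed.

Lemma tame_grad i l : tame (fun x => grad (phi i) x 0 l).
Proof.
split; first exact: measurable_grad.
pose G c := 'D_(delta_mx 0 l) (peval (cell_poly c i)).
(* The polynomial of a cell is defined everywhere, so its derivative is bounded on the compact
   closure of [Omega]. *)
have bG c : exists C, 0 <= C /\ forall x, closure Omega x -> `|G c x| <= C.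
  have [ne|em] := pselect (closure Omega !=set0); last first.
    by exists 0; split => // x Ox; exfalso; apply: em; exists x.
  have cO : compact (closure Omega).
    by apply: bounded_closed_compact; [exact: bounded_closure|exact: closed_closure].
  have cG x : closure Omega x -> {for x, continuous (fun x => `|G c x|)}.
    move=> _; have cG : {for x, continuous (G c)} := (C1_meval (cell_poly c i)).2 _ x.
    exact: (cvg_norm cG).
  have [C [[x0 _ <-] CG]] := compact_max cO ne cG.
  by exists `|G c x0|.
have /choice[C CP] := bG.
exists (\sum_c C c) => x Ox [c _ cx]; rewrite (grad_cell _ _ cx).
apply: (@le_trans _ _ (C c)); first by apply: (CP c).2; exact: subset_closure.
rewrite (bigD1 c)//= lerDl; apply: sumr_ge0 => c' _; exact: (CP c').1.
Qed.

Lemma tame_integrable f : tame f -> mu.-integrable Omega (EFin \o f).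
Proof.
move=> [mf [C fC]].
apply/(negligible_integrable mskel mO _ mu_skel); first exact/measurable_EFinP.
have OE : Omega `\` skel = Omega `&` cells.
  apply/seteqP; split => [x [Ox nx]|x [Ox cx]]; split => //.
    by apply: contrapT => cx; apply: nx.
  by case.
rewrite OE; have mOc : measurable (Omega `&` cells : set EC).
  by apply: measurableI => //; apply: open_caratheodory; exact: open_cells.
apply: measurable_bounded_integrable => //.
- by apply: le_lt_trans muO; apply: le_outer_measure; exact: subIsetl.
- by apply: measurable_funS mf => //; exact: subIsetl.
- exists C; split; first exact: num_real.
  by move=> a Ca x [Ox cx] /=; apply: le_trans (fC x Ox cx) _; exact: ltW.
Qed.

Lemma Rintegral_sum (I : Type) (r : seq I) (F : I -> E -> R) : (forall i, tame (F i)) ->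
  (\int[mu]_(x in Omega) (\sum_(i <- r) F i x) = \sum_(i <- r) \int[mu]_(x in Omega) F i x)%R.
Proof.
move=> tF; elim: r => [|i r IH].
  rewrite big_nil; under eq_Rintegral do rewrite big_nil.
  by rewrite Rintegral_cst ?mul0r.
rewrite big_cons -IH -RintegralD//; last 2 first.
- exact: tame_integrable.
- by apply: tame_integrable; exact: tame_sum.
by apply: eq_Rintegral => x _; rewrite big_cons.
Qed.

(** A combination of gradients rather than the gradient of the combination: it is linear in v at
    every point, even where gradients do not exist. *)
Definition lgrad (v : 'rV[R]_N) (x : E) (l : 'I_n.+1) : R :=
  \sum_i v 0 i * grad (phi i) x 0 l.

Lemma tame_lgrad v l : tame (fun x => lgrad v x l).
Proof.
by apply: tame_sum => i; apply: tameM; [exact: tame_cst|exact: tame_grad].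
Qed.

Definition energy (k : E -> R) v w x : R := \sum_l lgrad v x l * (k x * lgrad w x l).

Lemma tame_energy k v w : tame k -> tame (energy k v w).
Proof.
move=> tk; apply: tame_sum => l.
exact: tameM (tame_lgrad _ _) (tameM tk (tame_lgrad _ _)).
Qed.

Lemma form_stiffness k v w : tame k ->
  bform (stiffness Omega k phi) v w = (\int[mu]_(x in Omega) energy k v w x)%R.
Proof.
move=> tk.
pose F i j x := \sum_l grad (phi i) x 0 l * (k x * grad (phi j) x 0 l).
have tF i j : tame (F i j).
  by apply: tame_sum => l; exact: tameM (tame_grad _ _) (tameM tk (tame_grad _ _)).
have energyE x : energy k v w x = \sum_i \sum_j (v 0 i * w 0 j) * F i j x.
  transitivity (\sum_l \sum_i \sum_j (v 0 i * w 0 j) *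
      (grad (phi i) x 0 l * (k x * grad (phi j) x 0 l))).
    apply: eq_bigr => l _; rewrite /lgrad mulr_suml; apply: eq_bigr => i _.
    by rewrite !mulr_sumr; apply: eq_bigr => j _; ring.
  rewrite exchange_big; apply: eq_bigr => i _.
  by rewrite exchange_big; apply: eq_bigr => j _; rewrite mulr_sumr.
under eq_Rintegral do rewrite energyE.
have tvF i j : tame (fun x => v 0 i * w 0 j * F i j x).
  by apply: tameM => //; exact: tame_cst.
rewrite Rintegral_sum => [|i]; last exact: tame_sum.
rewrite form_sum; apply: eq_bigr => i _; rewrite Rintegral_sum//.
apply: eq_bigr => j _; rewrite mxE.
rewrite (@RintegralZl _ _ _ mu Omega (F i j)) //; last exact: tame_integrable.
by rewrite mulrAC.
Qed.

Lemma stiffness_sym k : (stiffness Omega k phi)^T = stiffness Omega k phi.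
Proof.
apply/matrixP => i j; rewrite !mxE; apply: eq_Rintegral => x _.
by apply: eq_bigr => l _; rewrite mulrCA [RHS]mulrCA [grad _ _ _ _ * grad _ _ _ _]mulrC.
Qed.

Lemma lgrad_supp (v : 'rV[R]_N) x l : (forall j, supp (phi j) x -> v 0 j = 0) ->
  lgrad v x l = 0.
Proof.
move=> vx; apply: big1 => j _.
have [/vx->|nx] := pselect (supp (phi j) x); first by rewrite mul0r.
suff -> : grad (phi j) x 0 l = 0 by rewrite mulr0.
rewrite mxE -(@derive_cst R E R 0 x (delta_mx 0 l)); apply: near_derive.
have oS : open (~` supp (phi j)) by apply: closed_openC; exact: closed_closure.
have := open_nbhs_nbhs (conj oS nx : open_nbhs x _); apply: filterS => y ny.
by apply/eqP; apply: contrapT => py; apply: ny; apply: subset_closure; apply/negP.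
Qed.

(* Pointwise this is |k - kap| <= r together with 2|ab| <= a^2 + b^2. *)
Lemma stiffness_perturbation k (J : {set 'I_N}) (kap r : R) (v w : 'rV[R]_N) : tame k -> 0 <= r ->
    (forall j x, j \in J -> supp (phi j) x -> `|k x - kap| <= r) ->
    (forall j, j \notin J -> v 0 j = 0) ->
  2 * (bform (stiffness Omega k phi) v w - kap * bform (stiffness Omega (cst 1) phi) v w) <=
  r * (bform (stiffness Omega (cst 1) phi) v v + bform (stiffness Omega (cst 1) phi) w w).
Proof.
move=> tk r0 kJ vJ; have t1 : tame (cst 1) := tame_cst 1.
rewrite !form_stiffness// -!RintegralZl//; try (by apply: tame_integrable; exact: tame_energy).
have te k' v' w' a : tame k' -> mu.-integrable Omega (EFin \o (fun x => a * energy k' v' w' x)).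
  by move=> tk'; apply: tame_integrable; apply: tameM; [exact: tame_cst|exact: tame_energy].
have tee k' v' w' : tame k' -> mu.-integrable Omega (EFin \o (energy k' v' w')).
  by move=> tk'; apply: tame_integrable; exact: tame_energy.
rewrite -RintegralB//; [|exact: tee|exact: te].
rewrite -RintegralD//; [|exact: tee|exact: tee].
rewrite -!RintegralZl//; last 2 first.
- by apply: tame_integrable; apply: tameD; exact: tame_energy.
- apply: tame_integrable; apply: tameD; first exact: tame_energy.
  under eq_fun do rewrite -mulNr.
  by apply: tameM; [exact: tame_cst|exact: tame_energy].
apply: le_Rintegral => //.
- apply: tame_integrable; apply: tameM; first exact: tame_cst.
  apply: tameD; first exact: tame_energy.
  under eq_fun do rewrite -mulNr.
  by apply: tameM; [exact: tame_cst|exact: tame_energy].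
- apply: tame_integrable; apply: tameM; first exact: tame_cst.
  by apply: tameD; exact: tame_energy.
move=> x Ox; rewrite /energy /cst mulr_sumr -sumrB mulr_sumr -big_split mulr_sumr.
apply: ler_sum => l _ /=.
set a := lgrad v x l; set b := lgrad w x l.
have [a0|a0] := eqVneq a 0.
  by rewrite a0 !(mul0r, mulr0, subrr) add0r mul1r mulr_ge0// -expr2 sqr_ge0.
(* Where v has a nonzero gradient component, some support belonging to J contains x, so the bound on
   k - kap applies. *)
have [j jJ xj] : exists2 j, j \in J & supp (phi j) x.
  apply: contrapT => H; move/eqP: a0; apply; apply: lgrad_supp => j xj.
  by apply: vJ; apply/negP => jJ; apply: H; exists j.
have /ler_normlP[k1 k2] := kJ j x jJ xj.
have -> : 2 * (a * (k x * b) - kap * (a * (1 * b))) = (k x - kap) * (2 * a * b) by ring.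
have -> : r * (a * (1 * a) + b * (1 * b)) = r * (a ^+ 2 + b ^+ 2) by ring.
have ab1 : 0 <= (a + b) ^+ 2 by exact: sqr_ge0.
have ab2 : 0 <= (a - b) ^+ 2 by exact: sqr_ge0.
(* Half the sum of this product and the next is the right side minus the left side. *)
have : 0 <= (r - (k x - kap)) * (a + b) ^+ 2 by apply: mulr_ge0 => //; lra.
have : 0 <= (r + (k x - kap)) * (a - b) ^+ 2 by apply: mulr_ge0 => //; lra.
lra.
Qed.

Lemma stiffness_lower k (alpha : R) (v : 'rV[R]_N) : tame k -> (forall x, Omega x -> alpha <= k x) ->
  alpha * bform (stiffness Omega (cst 1) phi) v v <= bform (stiffness Omega k phi) v v.
Proof.
move=> tk ka; have t1 : tame (cst 1) := tame_cst 1.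
have te k' : tame k' -> mu.-integrable Omega (EFin \o energy k' v v).
  by move=> tk'; apply: tame_integrable; exact: tame_energy.
rewrite !form_stiffness// -RintegralZl//; last exact: te.
apply: le_Rintegral => //.
- by apply: tame_integrable; apply: tameM; [exact: tame_cst|exact: tame_energy].
- exact: te.
move=> x Ox; rewrite /energy mulr_sumr; apply: ler_sum => l _ /=.
set a := lgrad v x l.
have -> : alpha * (a * (1 * a)) = alpha * a ^+ 2 by ring.
have -> : a * (k x * a) = k x * a ^+ 2 by ring.
by apply: ler_wpM2r; [exact: sqr_ge0|exact: ka].
Qed.

Let V (v : 'rV[R]_N) (x : E) : R := \sum_i v 0 i * phi i x.

(** The segment from x to y may leave [Omega], where nothing is known. It stays inside near x, so
    the polynomial is constant on an initial piece, and hence on the whole segment. *)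
Lemma lgrad_eq0_const (v : 'rV[R]_N) c :
    (forall x l, Omega x -> (cell M c)° x -> lgrad v x l = 0) ->
  exists a, forall y, cell M c y -> V v y = a.
Proof.
move=> g0.
have [x [Ox cx]] : (Omega `&` (cell M c)°) !=set0.
  have [x cx] := cell_interior_neq0 c.
  apply: (cell_closure (interior_subset cx)).
  exact: (open_nbhs_nbhs (conj (@open_interior _ (cell M c)) cx)).
exists (V v x) => y cy.
pose P z := \sum_i v 0 i * peval (cell_poly c i) z.
have PE z : cell M c z -> V v z = P z.
  by move=> cz; apply: eq_bigr => i _; rewrite (cell_polyE _ cz).
have PC1 : C1 P by apply: C1_sum => i; apply: C1M; [exact: C1_cst|exact: C1_meval].
have DP z u : Omega z -> (cell M c)° z -> 'D_u P z = 0.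
  move=> Oz cz; rewrite derive_sum_coord; last exact: PC1.1.
  apply: big1 => l _; suff -> : 'D_(delta_mx 0 l) P z = 0 by rewrite mulr0.
  rewrite -(g0 z l Oz cz) /lgrad /P.
  have -> : (fun z => \sum_i v 0 i * peval (cell_poly c i) z) =
      \sum_i (v 0 i *: (peval (cell_poly c i) : E -> R)).
    by apply/funext => z'; rewrite fct_sumE.
  rewrite derive_sum => [|i]; last first.
    by apply: derivableZ; apply: C1_derivable; exact: C1_meval.
  apply: eq_bigr => i _; rewrite deriveZ; last by apply: C1_derivable; exact: C1_meval.
  by rewrite (grad_cell _ _ cz).
have [q qP] : exists q : {poly R}, forall t, q.[t] = P (x + t *: (y - x)).
  have /choice[q qE] := fun i => meval_line (cell_poly c i) x (y - x).
  exists (\sum_i v 0 i *: q i) => t; rewrite horner_sum.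
  by apply: eq_bigr => i _; rewrite hornerZ qE.
have oW : open (Omega `&` (cell M c)°) by apply: openI => //; exact: open_interior.
have /nbhs_ballP[e /= e0 eW] := open_nbhs_nbhs (conj oW (conj Ox cx)).
have n1 : 0 < `|y - x| + 1 by rewrite ltr_wpDl.
pose d := e / (`|y - x| + 1).
have d0 : 0 < d by rewrite divr_gt0.
have line t : 0 <= t < d -> (Omega `&` (cell M c)°) (x + t *: (y - x)).
  move=> /andP[t0 td]; apply: eW; rewrite mx_norm_ball /ball_/= opprD addrA subrr add0r.
  rewrite normrN normrZ ger0_norm//.
  apply: (@le_lt_trans _ _ (t * (`|y - x| + 1))); first by rewrite ler_wpM2l// lerDl.
  by rewrite -ltr_pdivlMr.
have q0 : q - q.[0]%:P = 0.
  apply/eqP; apply: contraT => qn0.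
  have [t /andP[t0 td]] := poly_nonroot qn0 d0.
  rewrite !hornerE => /eqP; case; apply/eqP; rewrite subr_eq0; apply/eqP.
  have dq s : 0 <= s < d -> is_derive s 1 (fun s => P (x + s *: (y - x))) 0.
    move=> /line[Os cs]; rewrite -(DP _ (y - x) Os cs); apply: is_derive_line.
    exact: C1_derivable.
  have [||s _] := @MVT R (fun s => P (x + s *: (y - x))) (fun=> 0) 0 t t0.
  - move=> s; rewrite in_itv/= => /andP[s0 st]; apply: dq.
    by rewrite ltW// (lt_trans st).
  - apply: derivable_within_continuous => s; rewrite in_itv/= => /andP[s0 st].
    by have [] : is_derive s 1 (fun s => P (x + s *: (y - x))) 0
      by apply: dq; rewrite s0 (le_lt_trans st).
  by rewrite mul0r -!qP => /eqP; rewrite subr_eq0 => /eqP.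
have /(congr1 (fun p => p.[1])) := q0; rewrite !hornerE !qP => /eqP.
rewrite subr_eq0 scale1r scale0r addr0 [x + _]addrC subrK => /eqP.
by rewrite !PE//; exact: interior_subset.
Qed.

(* Otherwise the function represented by v would be constant on each cell, hence
   have finitely many values, while being continuous and zero far away. *)
Lemma stiffness_posdef : posdef (stiffness Omega (cst 1) phi).
Proof.
move=> v v0; have t1 : tame (cst 1) := tame_cst 1.
have en0 x : 0 <= energy (cst 1) v v x.
  by apply: sumr_ge0 => l _; rewrite mul1r -expr2 sqr_ge0.
rewrite form_stiffness// lt_neqAle Rintegral_ge0// andbT.
apply/eqP => int0.
have ie := tame_integrable (tame_energy v v t1).
have intE : (\int[mu]_(x in Omega) `|(energy (cst 1) v v x)%:E| = 0)%E.
  under eq_integral do rewrite gee0_abs ?lee_fin//.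
  by rewrite -[LHS]fineK ?integrable_fin_num//; congr EFin; rewrite [RHS]int0.
have /ae_eq_integral_abs := intE.
case/(_ mO) => [|Z [mZ Z0 subZ]]; first by case/integrableP: ie.
have lg0 x c l : Omega x -> (cell M c)° x -> lgrad v x l = 0.
  move=> Ox cx; apply: contrapT => /eqP lx.
  (* A continuous function equal to this gradient component inside the cell: if it is nonzero at x,
     it is so on a nonempty open set, which is not null. *)
  pose G := \sum_i (v 0 i *: 'D_(delta_mx 0 l) (peval (cell_poly c i))) : E -> R.
  have GE y : (cell M c)° y -> G y = lgrad v y l.
    by move=> cy; rewrite /G fct_sumE; apply: eq_bigr => i _; rewrite (grad_cell _ _ cy).
  have cG : continuous G.
    move=> y; rewrite /G fct_sumE; apply: continuous_sumr => i _.
    have cD : {for y, continuous ('D_(delta_mx 0 l) (peval (cell_poly c i)))} :=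
      (C1_meval (cell_poly c i)).2 _ y.
    exact: (cvgM (cvg_cst (v 0 i)) cD).
  pose A := Omega `&` (cell M c)° `&` G @^-1` [set r | r != 0].
  have oA : open A.
    apply: openI; first by apply: openI => //; exact: open_interior.
    by apply: open_comp; [move=> y _; exact: cG|exact: open_neq].
  have : (0 < lebesgue_outer A)%E by apply: open_outer_gt0 => //; exists x; split => //=; rewrite GE.
  apply/negP; rewrite -leNgt; rewrite -Z0; apply: le_outer_measure.
  move=> y [[Oy cy] Gy]; apply: subZ => /= /(_ Oy) [].
  move=> /eqP; rewrite psumr_eq0 => [/allP/(_ l)|l' _]; last first.
    by rewrite mul1r -expr2 sqr_ge0.
  rewrite mem_index_enum mul1r mulf_eq0 orbb -(GE y cy) => /(_ isT) /eqP Gy0.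
  by move: Gy; rewrite /= Gy0 eqxx.
have /choice[a aP] := fun c => lgrad_eq0_const (fun x l => @lg0 x c l).
have Vrange y : V v y \in 0 :: [seq a c | c <- enum 'I_(ncell M)].
  rewrite inE; have [Oy|Oy] := pselect (Omega y); last first.
    by rewrite /V big1 ?eqxx// => i _; rewrite (basis_zero phi_basis) ?mulr0.
  have [c _ cy] : (\bigcup_c cell M c) y by rewrite (cell_cover M); exact: subset_closure.
  by rewrite (aP c y cy) orbC map_f ?mem_enum.
have [j vj] : exists j, v 0 j != 0.
  apply/existsP; apply: contraR v0 => /existsPn vj; apply/eqP/rowP => i.
  by rewrite [RHS]mxE; apply/eqP; rewrite -[_ == _]negbK.
set x := node M (dof j).
have Vx : V v x = v 0 j.
  rewrite /V (bigD1 j)//= basis_at_node// mulr1 big1 ?addr0// => i ij.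
  by rewrite (basis_nodal phi_basis) (negbTE ij) mulr0.
have cV : continuous (V v).
  move=> y; apply: continuous_sumr => i _.
  have cp : {for y, continuous (phi i)} := basis_continuous phi_basis (j := i) (x := y).
  exact: (cvgM (cvg_cst (v 0 i)) cp).
pose e : E := delta_mx 0 0.
have [C C0 OC] := pinfty_ex_gt0 bO.
(* Far enough for the first coordinate of x + t e to exceed the bound C of [Omega]. *)
pose t := C + 1 + `|x 0 0|.
have t0 : 0 < t by rewrite /t; have := normr_ge0 (x 0 0); lra.
have Vt : V v (x + t *: e) = 0.
  apply: big1 => i _; rewrite (basis_zero phi_basis) ?mulr0// => /OC /= nC.
  have : `|(x + t *: e) 0 0| <= `|x + t *: e|.
    by rewrite [leRHS]/Num.Def.normr/= mx_normrE; apply/bigmax_geP; right; exists (0, 0).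
  rewrite !mxE !eqxx mulr1; have := ler_norm (x 0 0 + t); have := ler_norm (- x 0 0).
  rewrite normrN /t; lra.
have cg : {within `[0, t], continuous (fun s : R => V v (x + s *: e))}.
  apply: continuous_subspaceT => s.
  apply: (@continuous_comp _ _ _ (fun s : R => x + s *: e) (V v)); last exact: cV.
  exact: (cvgD (cvg_cst x) (cvgZ (cvg_id) (cvg_cst e))).
(* Its roots are all the possible values of V v, with 0 for the points outside [Omega]. The
   intermediate value theorem yields a value between 0 and [v 0 j] that is not a root. *)
pose q := \prod_(r <- 0 :: [seq a c | c <- enum 'I_(ncell M)]) ('X - r%:P).
have qn0 : q != 0 by apply: monic_neq0; exact: monic_prod_XsubC.
have mM : Num.min 0 (v 0 j) < Num.max 0 (v 0 j).
  by rewrite lt_max !gt_min ltxx/= !ltxx !orbF /=; case: ltgtP vj => //; rewrite ?eqxx.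
have [r /andP[r1 r2] qr] := poly_nonroot qn0 mM.
have [|s _ sr] := IVT (ltW t0) cg (v := r).
  rewrite scale0r addr0 Vx Vt minC maxC (ltW r1) (ltW r2) //.
by move: qr; rewrite -rootE root_prod_XsubC -sr Vrange.
Qed.

End Galerkin.

(** * The theorem *)

Theorem corollary3p2 (R : realType) (n : nat) (n_lt3 : (n < 3)%N)
    (Omega : set 'rV[R]_n.+1) (Omega_open : open Omega)
    (Omega_connected : connected Omega) (Omega_neq0 : Omega !=set0)
    (Omega_bounded : bounded_set Omega)
    (k : 'rV[R]_n.+1 -> R)
    (k_measurable : measurable_fun
       (Omega : set (caratheodory_type (@lebesgue_outer R n))) k)
    (k_bounded : exists C : R, forall x, closure Omega x -> `|k x| <= C)
    (k_positive : exists2 alpha : R, 0 < alpha &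
       forall x, Omega x -> alpha <= k x)
    (M : mesh Omega) (N : nat) (dof : 'I_N -> 'I_(nnode M))
    (phi : 'I_N -> 'rV[R]_n.+1 -> R) (phi_basis : nodal_basis dof phi) :
  let A := stiffness Omega k phi in
  let L := stiffness Omega (cst 1) phi in
  let T := fun j => supp (phi j) in
  let kT := fun j => `[inf (k @` T j), sup (k @` T j)] in
  (exists2 lam : 'I_N -> R,
     ordered_spectrum (invmx L *m A) lam & forall i, 0 < lam i) /\
  forall lam : 'I_N -> R, ordered_spectrum (invmx L *m A) lam ->
  (exists pi : {perm 'I_N}, forall j, lam (pi j) \in kT j) /\
  forall pi : {perm 'I_N}, (forall j, lam (pi j) \in kT j) ->
  forall (j : 'I_N) (p : 'I_(nnode M)), T j (node M p) ->
  let xhat := node M p in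
  `|lam (pi j) - k xhat| <= sup [set `|k x - k xhat| | x in T j] /\
  forall (U : set 'rV[R]_n.+1) (K : 'rV[R]_n.+1 -> R),
    C2_extension (T j) k U K ->
    exists osc hhat D2max : R,
    [/\ is_max_on (T j) (fun x => `|k x - k xhat|) osc,
        is_max_on (T j) (fun x => enorm (x - xhat)) hhat,
        is_max_on (T j) (norm_D2 K) D2max,
        `|lam (pi j) - k xhat| <= osc &
        [\/ n = 0%N, p = dof j | star_shaped_about xhat (T j)] ->
        osc <= hhat * enorm (grad K xhat) + 2^-1 * hhat ^+ 2 * D2max].
Proof.
move=> A L T kT; have [C kC] := k_bounded; have [alpha alpha0 ka] := k_positive.
have tk : tame M k.
  by split => //; exists C => x Ox _; apply: kC; exact: subset_closure.
have Lp : posdef L := stiffness_posdef Omega_open Omega_bounded phi_basis.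
have As : A^T = A := stiffness_sym _ _ _.
have Ls : L^T = L := stiffness_sym _ _ _.
have [P [d [PL PA]]] := pencil_diagonalisation As Ls Lp.
have charE := char_poly_pencil PL PA.
(* d_i is the form of A at the i-th row of P, hence at least alpha times the form of L there, which
   is positive. *)
have d0 i : 0 < d 0 i.
  have Pu : P \in unitmx by move: PL; rewrite -mulmxA => /mulmx1_unit[].
  have ev : delta_mx 0 i *m P != 0 :> 'rV[R]_N.
    apply/eqP => /(congr1 (mulmx^~ (invmx P))); rewrite mulmxK// mul0mx.
    by move=> /rowP/(_ i); rewrite !mxE !eqxx => /eqP; rewrite oner_eq0.
  have := stiffness_lower Omega_open Omega_bounded phi_basis (delta_mx 0 i *m P) tk ka.
  have -> : bform (stiffness Omega k phi) (delta_mx 0 i *m P) (delta_mx 0 i *m P) = d 0 i.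
    rewrite form_mul -/A PA form_diag (bigD1 i)//= big1 => [|j ji].
      by rewrite !mxE !eqxx !mulr1 addr0.
    by rewrite !mxE eqxx (negbTE ji) mulr0.
  by apply: lt_le_trans; rewrite mulr_gt0// Lp.
split.
  have [lam [lam_homo lamE]] := sorted_spectrum (fun i => d 0 i).
  exists lam; first by split => //; rewrite charE.
  move=> i; rewrite ltNge; apply/negP => li.
  have := prod_XsubC_card (fun r => r <= 0) lamE.
  rewrite [LHS]eq_card0 => [/esym/eqP|j]; last by rewrite !inE leNgt d0.
  by rewrite cards_eq0 => /eqP/setP/(_ i); rewrite !inE li.
move=> lam [_ lamE].
have dE : \prod_i ('X - (d 0 i)%:P) = \prod_i ('X - (lam i)%:P) by rewrite -charE.
have Tnode j : T j (node M (dof j)).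
  by apply: subset_closure => /=; rewrite (basis_at_node phi_basis) oner_eq0.
have TC j x : T j x -> `|k x| <= C by move=> /(supp_closure phi_basis)/kC.
have Tinf j x : T j x -> inf (k @` T j) <= k x.
  move=> Tx; apply: ge_inf; last by exists x.
  by exists (- C) => _ [y /TC + <-]; rewrite ler_norml => /andP[].
have Tsup j x : T j x -> k x <= sup (k @` T j).
  move=> Tx; apply: ub_le_sup; last by exists x.
  by exists C => _ [y /TC + <-]; rewrite ler_norml => /andP[].
split.
  have [||pi pP] := @interval_matching_perm R 'I_N lam
      (fun j => inf (k @` T j)) (fun j => sup (k @` T j)).
  - by move=> j; apply: le_trans (Tinf j _ (Tnode j)) (Tsup j _ (Tnode j)).
  - move=> s t st; set J := [set j | _]%SET.
    have key (i : 'I_N) (x : 'I_N -> R) :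
        (`|x i - (s + t) / 2| <= (t - s) / 2) = (s <= x i <= t).
      by rewrite ler_norml; apply/andP/andP => -[h1 h2]; split; lra.
    rewrite -(prod_XsubC_card (fun r => s <= r <= t) dE).
    have r0 : 0 <= (t - s) / 2 by rewrite divr_ge0// subr_ge0.
    have kJ j x : j \in J -> supp (phi j) x -> `|k x - (s + t) / 2| <= (t - s) / 2.
      rewrite inE => /andP[sj tj] Tx.
      have h1 := Tinf j x Tx; have h2 := Tsup j x Tx.
      by rewrite ler_norml; apply/andP; split; lra.
    apply: leq_trans (pencil_count PL PA (fun v w =>
      stiffness_perturbation Omega_open Omega_bounded phi_basis w tk r0 kJ)) _.
    by apply: subset_leq_card; apply/fintype.subsetP => i; rewrite !inE key.
  - by exists pi => j; rewrite in_itv/=; exact: pP.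
move=> pi piP j p Tp xhat.
(* If D bounds the oscillation about xhat, then inf k and sup k over T_j, and the eigenvalue between
   them, lie within D of k xhat. *)
have lam_le (D : R) : (forall x, T j x -> `|k x - k xhat| <= D) ->
    `|lam (pi j) - k xhat| <= D.
  move=> kD; have := piP j; rewrite in_itv/= => /andP[l1 l2].
  have s1 : sup (k @` T j) <= k xhat + D.
    apply: ge_sup => [|_ [x /kD + <-]]; first by exists (k xhat); exists xhat.
    by rewrite ler_norml => /andP[_]; rewrite lerBlDl.
  have i1 : k xhat - D <= inf (k @` T j).
    apply: lb_le_inf => [|_ [x /kD + <-]]; first by exists (k xhat); exists xhat.
    by rewrite ler_norml => /andP[]; rewrite lerBrDl addrC.
  by rewrite ler_norml; apply/andP; split; lra.
split.
  apply: lam_le => x Tx; apply: ub_le_sup; last by exists x.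
  exists (C + C) => _ [y Ty <-]; apply: le_trans (ler_normB _ _) _.
  by apply: lerD; [exact: (TC j)|exact: (TC j)].
move=> U K [oU TU KC2 Kk].
have KE x : T j x -> K x = k x by move=> Tx; apply: Kk; rewrite inE.
have cT : compact (T j).
  apply: bounded_closed_compact; last exact: closed_closure.
  have [B [Br bB]] := bounded_closure Omega_bounded; exists B; split => // a Ba.
  by move=> x /(supp_closure phi_basis); exact: bB.
have T0 : T j !=set0 by exists xhat.
have [dK _ _] := KC2.
(* k agrees with [K] on T_j only, so maxima are found for [K] and transferred to k on T_j. *)
have cosc x : T j x -> {for x, continuous (fun x => `|K x - k xhat|)}.
  move=> Tx; have cK : {for x, continuous K}.
    by apply: differentiable_continuous; exact/dK/TU.
  exact: (cvg_norm (cvgB cK (cvg_cst (k xhat)))).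
have chat x : T j x -> {for x, continuous (fun x : 'rV[R]_n.+1 => enorm (x - xhat))}.
  move=> Tx; apply: (@continuous_comp _ _ _ (fun x : 'rV[R]_n.+1 => x - xhat) (@enorm R n)).
    exact: (cvgB cvg_id (cvg_cst xhat)).
  exact: enorm_continuous.
have cD2 x : T j x -> {for x, continuous (norm_D2 K)}.
  by move=> /TU; exact: norm_D2_continuous.
have [osc [[y Ty oscE] oscM]] := compact_max cT T0 cosc.
have [hhat hhatP] := compact_max cT T0 chat.
have [D2max D2P] := compact_max cT T0 cD2.
exists osc, hhat, D2max; split => //.
- split; first by exists y => //; rewrite -(KE y Ty).
  by move=> x Tx; rewrite -(KE x Tx); exact: oscM.
- by apply: lam_le => x Tx; rewrite -(KE x Tx); exact: oscM.
move=> cases; have star : star_shaped_about xhat (T j).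
  have nodeS := star_shaped_node phi_basis (j := j).
  by case: cases => [n0|pj|//]; [exact: star_shaped1 n0 nodeS Tp|rewrite /xhat pj].
rewrite -oscE -(KE xhat Tp).
apply: le_trans (taylor_star_shaped oU KC2 TU Tp Ty star D2P.2) _.
have hy : enorm (y - xhat) <= hhat := hhatP.2 y Ty.
have D2max0 : 0 <= D2max.
  exact: le_trans (norm_D2_ge0 oU KC2 (TU _ Tp)) (D2P.2 _ Tp).
apply: lerD; first by apply: ler_wpM2r => //; exact: enorm_ge0.
apply: ler_wpM2r => //; apply: ler_wpM2l; first by rewrite invr_ge0.
by rewrite lerXn2r// nnegrE ?enorm_ge0// (le_trans (enorm_ge0 _) hy).
Qed.
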